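(* Let $k$ be a positive integer and let $u\in C^0(\mathcal{I}_0,H^s(\mathbb{R}))$, $s>3/2$, be a solution of $$u_t-u_{txx}+u^ku_x-u^ku_{xxx}=0,\qquad u(0,x)=u_0(x).$$ If, for some $\theta\in(0,1)$, $$|u_0(x)|\sim O(e^{-\theta|x|})\quad\text{and}\quad|u_0'(x)|\sim O(e^{-\theta|x|})\quad\text{as }|x|\to\infty,$$ then $$|u(t,x)|\sim O(e^{-\theta|x|})\quad\text{and}\quad|u_x(t,x)|\sim O(e^{-\theta|x|})\quad\text{as }|x|\to\infty,$$ uniformly in $t\in\mathcal{I}_0$.
   Context: $H^s(\mathbb{R})$ is the usual Sobolev space. $T>0$ is the lifespan of the solution $u\in C^0([0,T);H^s(\mathbb{R}))\cap C^1([0,T);H^{s-1}(\mathbb{R}))$ (which exists and is unique by local well-posedness), $T_0\in(0,T)$ is arbitrary, and $\mathcal{I}_0=[0,T_0]$. The equation is understood in the equivalent form $u_t+u^ku_x=\tfrac{k(k-1)}{2}\Lambda^{-2}(u^{k-2}u_x^3)-\tfrac{3k}{2}\partial_x\Lambda^{-2}(u^{k-1}u_x^2)$, where $\Lambda^{-2}f=g\ast f$ with $g(x)=e^{-|x|}/2$ (the first term on the right being absent when $k=1$). Notation: $|f(x)|\sim O(h(x))$ as $|x|\to\infty$ means that there is a real constant $L$ with $\lim_{|x|\to\infty}|f(x)|/h(x)=L$; ''uniformly in $\mathcal{I}_0$'' means that the asymptotic relation holds uniformly with respect to $t\in\mathcal{I}_0$. *)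

(* Defs.v *)
From HB Require Import structures.
From mathcomp Require Import all_boot all_order all_algebra.
From mathcomp Require Import all_classical all_reals all_analysis.

Set Implicit Arguments.
Unset Strict Implicit.
Unset Printing Implicit Defensive.
Import Order.TTheory GRing.Theory Num.Theory.
Import numFieldNormedType.Exports.

Local Open Scope classical_set_scope.
Local Open Scope ring_scope.

(* The Sobolev space H^s(R) is only meant for s >= 0, where it consists of L^2
   functions. *)

(* [F] is the L^2 Fourier transform of [f], as defined by Plancherel's theorem:
   f^(xi) = lim_n \int_[-n, n] f(x) e^(- i x xi) dx, the limit being taken in
   L^2.  As f is real-valued, f^ is encoded by its cosine and sine parts:
   f^(xi) = (F xi).1 - i (F xi).2.  No factor 2 pi is put in the definition:
   it would only multiply the Sobolev norms by a constant. *)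
Definition is_fourier (R : realType) (f : R -> R) (F : R -> R * R) : Prop :=
  let mu := @lebesgue_measure R in
  let c (n : nat) (xi : R) :=
    \int[mu]_(x in `[- n%:R, n%:R]) (f x * cos (x * xi)) in
  let d (n : nat) (xi : R) :=
    \int[mu]_(x in `[- n%:R, n%:R]) (f x * sin (x * xi)) in
  [/\ f \in Lfun mu 2%:E,
      (fun xi => (F xi).1) \in Lfun mu 2%:E,
      (fun xi => (F xi).2) \in Lfun mu 2%:E,
      Lnorm mu 2%:E (fun xi => ((F xi).1 - c n xi)%:E) @[n --> \oo] --> 0%E &
      Lnorm mu 2%:E (fun xi => ((F xi).2 - d n xi)%:E) @[n --> \oo] --> 0%E].

(* || (1 + xi^2)^(s/2) f^ ||_(L^2).  The transform f^ is unique up to a null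
   set, so the infimum is over at most one value; it is +oo when f is not in
   L^2. *)
Definition sobolev_norm (R : realType) (s : R) (f : R -> R) : \bar R :=
  ereal_inf
    [set Lnorm (@lebesgue_measure R) 2%:E (fun xi =>
           ((1 + xi ^+ 2) `^ (s / 2)
            * Num.sqrt ((F xi).1 ^+ 2 + (F xi).2 ^+ 2))%:E)
    | F in is_fourier f].

Definition sobolev (R : realType) (s : R) (f : R -> R) : Prop :=
  (sobolev_norm s f < +oo)%E.

Definition sobolev_C0 (R : realType) (s : R) (J : set R) (w : R -> R -> R) :
    Prop :=
  (forall t, J t -> sobolev s (w t)) /\
  (forall t0, J t0 ->
     sobolev_norm s (fun x => w t x - w t0 x) @[t --> within J (nbhs t0)]
       --> 0%E).

(* One-sided at an endpoint of [J]. *)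
Definition sobolev_derivative (R : realType) (s : R) (J : set R)
    (w v : R -> R -> R) : Prop :=
  forall t0, J t0 ->
    sobolev_norm s (fun x => (w t x - w t0 x) / (t - t0) - v t0 x)
      @[t --> within J (t0^')] --> 0%E.

(* Lambda^(-2) f = g * f with g(x) = e^(-|x|) / 2. *)
Definition Lambda_m2 (R : realType) (f : R -> R) (x : R) : R :=
  \int[@lebesgue_measure R]_(y in [set: R]) (expR (- `|x - y|) / 2 * f y).

(* For k = 1 the truncated exponent k - 2 is harmless: the coefficient
   k (k - 1) / 2 is zero. *)
Definition nonlocal_rhs (R : realType) (k : nat) (f : R -> R) (x : R) : R :=
  (k * (k - 1))%N%:R / 2
    * Lambda_m2 (fun y => f y ^+ (k - 2)%N * derive1 f y ^+ 3) x
  - (3 * k)%N%:R / 2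
    * derive1 (Lambda_m2 (fun y => f y ^+ (k - 1)%N * derive1 f y ^+ 2)) x.

(* u in C^0(J; H^s) with time derivative v in C^0(J; H^(s-1)), solving the
   equation on J.  [u t] is the continuous representative of its class, and the
   equation is an identity in H^(s-1), i.e. almost everywhere in x. *)
Definition solution (R : realType) (k : nat) (s : R) (J : set R)
    (u : R -> R -> R) : Prop :=
  [/\ forall t, J t -> continuous (u t),
      sobolev_C0 s J u &
      exists v : R -> R -> R,
        [/\ sobolev_C0 (s - 1) J v,
            sobolev_derivative (s - 1) J u v &
            forall t, J t ->
              {ae @lebesgue_measure R, forall x,
                v t x + u t x ^+ k * derive1 (u t) x = nonlocal_rhs k (u t) x}]].

(* The filter "|x| -> oo" on the real line. *)
Definition norm_infty (R : realType) : set_system R :=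
  filter_from [set: R] (fun M => [set x | M < `|x|]).
Arguments norm_infty R : clear implicits.

Global Instance norm_infty_proper_filter (R : realType) :
  ProperFilter (norm_infty R).
Proof.
apply: filter_from_proper.
  apply: filter_from_filter; first by exists 0.
  move=> M N _ _; exists (Num.max M N) => // x /=.
  by rewrite gt_max => /andP[].
move=> M _; exists (`|M| + 1) => /=.
by rewrite ger0_norm ?addr_ge0// ltr_pwDr// ler_norm.
Qed.

(* |f(x)| ~ O(h(x)) as |x| -> oo; the quotient has a limit, the same one at
   both ends of the line. *)
Definition simO (R : realType) (f h : R -> R) : Prop :=
  exists L : R, `|f x| / h x @[x --> norm_infty R] --> L.

(* |f(t, x)| ~ O(h(x)) as |x| -> oo, uniformly in t in I: the constant is the
   same for all t, and the limit is uniform. *)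
Definition simO_uniform (R : realType) (I : set R) (f : R -> R -> R)
    (h : R -> R) : Prop :=
  exists L : R,
    {uniform I, (fun x t => `|f t x| / h x) @ norm_infty R --> (fun=> L)}.

(* Main.v *)
Require Import Defs.
From HB Require Import structures.
From mathcomp Require Import all_boot all_order all_algebra.
From mathcomp Require Import all_classical all_reals all_analysis.
From mathcomp Require Import measurable_realfun ring lra.
Import Order.TTheory GRing.Theory Num.Theory.
Import numFieldNormedType.Exports.
Local Open Scope classical_set_scope.
Local Open Scope ring_scope.

(** The Sobolev norms only enter through sup norms.  Pairing f in L^2 with the
    Poisson kernel P_e gives, by Fubini on [-n, n] and n -> oo,
    (f * P_e)(a) = 1/pi \int_0^oo e^(- e xi) (F1 cos (a xi) + F2 sin (a xi)) dxi;
    letting e -> 0 yields the inversion formula, whence H^s in C^0 for s > 1/2 and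
    H^s in C^1 for s > 3/2 with bounds.  So u is a classical solution, u and u_x
    are bounded on [0, T0], and u_t exists uniformly in x.

    With the weight max (e^(- theta |x|), e^(- theta N)), u is estimated by
    integrating the equation in time, and u_x by following it along the
    characteristics x' = u^k; since theta < 1, convolution with e^(- |x|) / 2
    respects the weight.  Short time steps give a bound independent of N, so that
    u and u_x are O(e^(- theta |x|)) uniformly on [0, T0].  Every term of the
    equations for u and u_x other than the transport of u_x is then
    O(e^(- theta' |x|)) with theta' > theta, and the characteristics move points
    near infinity by O(e^(- theta |x|)).  Hence u(t) and u_x(t) have the same
    limits relative to e^(- theta |x|) as u_0 and u_0'. *)

(** * Fourier inversion by the Poisson kernel *)

(** The equation for u_x contains u^k u_xx, and u_xx need not exist pointwise when s is close to
    3/2; in the equation for u, the term u^k u_x can be treated as an ordinary source. This is why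
    only u_x is followed along characteristics, and on difference quotients in x, whose increments
    in time involve u and u_x alone. No flow is constructed: it is enough to find a point of the
    backward cone with the right value of u_x, so steps whose errors add up to an arbitrarily small
    total suffice. At positive times the ratio of u to e^(- theta |x|) is not known to be bounded,
    so with this weight there would be no finite quantity to absorb; with the truncated weight,
    every bounded function has a finite ratio. Of the weight, the propagation estimates use om y <=
    e^(theta |x - y|) om x, which survives truncation, and positivity. As k >= 1, every source has
    at least two factors among u and u_x: in the first estimate one of them carries the weight and
    the others are merely bounded, in the second one two of them carry it. This square is the gain
    that allows theta' > theta. *)

Section FourierInversion.
Context {R : realType}.
Notation mu := (@lebesgue_measure R).

Lemma expRN_cvgy (e : R) : 0 < e -> expR (- e * x) @[x --> +oo] --> (0 : R).
Proof.
move=> e0.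
have -> : (fun x => expR (- e * x)) = (fun x => expR (- x)) \o (fun x => e * x).
  by apply/funext => x /=; rewrite mulNr.
apply: (cvg_comp _ _ _ (@cvgr_expR R)).
by apply: gt0_cvgMry => //; exact: cvg_id.
Qed.

(* The summand 1 makes the integrand nonnegative, as the fundamental theorem of
   calculus on a half-line requires; it is subtracted again in
   [integral_expRN_cos]. *)
Lemma poisson_primitive (e z x : R) : 0 < e ->
  is_derive x 1
    (fun y => expR (- e * y) * (z * sin (z * y) - e * cos (z * y)) / (e ^+ 2 + z ^+ 2)
              - expR (- e * y) / e)
    (expR (- e * x) * (1 + cos (z * x))).
Proof.
move=> e0; apply: is_derive_eq; rewrite /GRing.scale /=.
have h : e ^+ 2 + z ^+ 2 != 0 by rewrite gt_eqF// ltr_pwDl ?sqr_ge0// exprn_gt0.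
have h' : e != 0 by rewrite gt_eqF.
by field; rewrite h h'.
Qed.

Lemma exp_primitive (e x : R) : 0 < e ->
  is_derive x 1 (fun y => - (expR (- e * y) / e)) (expR (- e * x)).
Proof.
move=> e0; apply: is_derive_eq; rewrite /GRing.scale /=.
have h' : e != 0 by rewrite gt_eqF.
by field; rewrite h'.
Qed.

Lemma is_derive_FTC2y (f F : R -> R) (l : R) :
  (forall x, 0 <= f x) -> continuous f -> (forall x : R, is_derive x 1 F (f x)) ->
  F x @[x --> +oo] --> l ->
  (\int[mu]_(x in `[0%R, +oo[) (f x)%:E = (l - F 0)%:E)%E.
Proof.
move=> f0 cf dF Fl.
have cF : continuous F.
  by move=> x; apply/differentiable_continuous/derivable1_diffP; case: (dF x).
rewrite (@ge0_continuous_FTC2y _ f F 0 l)//.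
- by apply/continuous_subspaceT.
- exact/cvg_at_right_filter/cF.
- by move=> x _; rewrite derive1E; exact: derive_val.
Qed.

Lemma continuous_expRM (e : R) : continuous (fun x : R => expR (e * x)).
Proof.
move=> x; apply: (@continuous_comp _ _ _ (fun x => e * x) expR).
  exact: mulrl_continuous.
exact: continuous_expR.
Qed.

Lemma continuous_cosM (z : R) : continuous (fun x : R => cos (z * x)).
Proof.
move=> x; apply: (@continuous_comp _ _ _ (fun x => z * x) cos).
  exact: mulrl_continuous.
exact: continuous_cos.
Qed.

Lemma expRN_cvgyM (e c : R) : 0 < e -> expR (- e * x) * c @[x --> +oo] --> (0 : R).
Proof.
move=> e0; rewrite -[X in _ --> X](mul0r c); apply: cvgMr_tmp.
exact: expRN_cvgy.
Qed.

Lemma integral_expRN (e : R) : 0 < e ->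
  (\int[mu]_(x in `[0%R, +oo[) (expR (- e * x))%:E = (e^-1)%:E)%E.
Proof.
move=> e0.
rewrite (is_derive_FTC2y _ _ 0 _ _ (fun x => exp_primitive e x e0)).
- by rewrite mulr0 expR0 mul1r sub0r opprK.
- by move=> x; exact: expR_ge0.
- exact: continuous_expRM.
- by rewrite -[X in _ --> X]oppr0; apply: cvgN; exact: expRN_cvgyM.
Qed.

Lemma integrable_expRN (e : R) : 0 < e ->
  mu.-integrable `[0%R, +oo[ (EFin \o (fun x => expR (- e * x))).
Proof.
move=> e0; apply/integrableP; split.
  apply/measurable_EFinP; apply: measurable_funTS.
  apply: continuous_measurable_fun; exact: continuous_expRM.
under eq_integral do rewrite gee0_abs ?lee_fin ?expR_ge0//.
by rewrite /= integral_expRN// ltry.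
Qed.

Lemma integral_expRN_cos (e z : R) : 0 < e ->
  \int[mu]_(x in `[0%R, +oo[) (expR (- e * x) * cos (z * x)) = e / (e ^+ 2 + z ^+ 2).
Proof.
move=> e0.
have ie := integrable_expRN e e0.
have i2 : (\int[mu]_(x in `[0%R, +oo[) (expR (- e * x) * (1 + cos (z * x)))%:E
    = (e^-1 + e / (e ^+ 2 + z ^+ 2))%:E)%E.
  rewrite (is_derive_FTC2y _ _ 0 _ _ (fun x => poisson_primitive e z x e0)).
  - rewrite !mulr0 sin0 expR0 cos0; congr EFin.
    have h : e ^+ 2 + z ^+ 2 != 0 by rewrite gt_eqF// ltr_pwDl ?sqr_ge0// exprn_gt0.
    have h' : e != 0 by rewrite gt_eqF.
    by field; rewrite h h'.
  - by move=> x; rewrite mulr_ge0 ?expR_ge0//.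
  - move=> x; apply: cvgM; first exact: continuous_expRM.
    by apply: cvgD; [exact: cvg_cst|exact: continuous_cosM].
  - rewrite -[X in _ --> X](subr0 0); apply: cvgB; last exact: expRN_cvgyM.
    rewrite -[X in _ --> X](mul0r (e ^+ 2 + z ^+ 2)^-1); apply: cvgMr_tmp.
    apply/norm_cvg0P.
    apply: (@squeeze_cvgr _ _ _ _ (cst 0) (fun x => expR (- e * x) * (`|z| + e))).
    + near=> x; rewrite normr_ge0/= normrM (ger0_norm (expR_ge0 _)) ler_wpM2l ?expR_ge0//.
      rewrite (le_trans (ler_normB _ _))// lerD//.
        by rewrite normrM ler_piMr// ler_norml sin_geN1 sin_le1.
      by rewrite normrM (gtr0_norm e0) ler_piMr ?(ltW e0)// ler_norml cos_geN1 cos_le1.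
    + exact: cvg_cst.
    + exact: expRN_cvgyM.
have -> : (fun x => expR (- e * x) * cos (z * x)) =
    (fun x => expR (- e * x) * (1 + cos (z * x)) - expR (- e * x)).
  by apply/funext => x; rewrite mulrDr mulr1 addrAC subrr add0r.
rewrite RintegralB//; last first.
  apply/integrableP; split.
    apply/measurable_EFinP; apply: measurable_funTS.
    apply: continuous_measurable_fun => x; apply: cvgM; first exact: continuous_expRM.
    by apply: cvgD; [exact: cvg_cst|exact: continuous_cosM].
  rewrite /=.
  under eq_integral do (rewrite ger0_norm; last
    by (rewrite mulr_ge0 ?expR_ge0//; have := cos_geN1 (z * x); lra)).
  by rewrite i2 ltry.
by rewrite /Rintegral i2 integral_expRN//= addrAC subrr add0r.
Unshelve. all: end_near. Qed.

(** The Poisson kernel of the half-plane at height [e], centred at [a], without its factor 1 / pi.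
    By [integral_expRN_cos] it is the Laplace transform of cos ((x - a) xi) in xi, which links it to
    the Fourier transform. *)
Definition poissonk (e a x : R) : R := e / (e ^+ 2 + (x - a) ^+ 2).

Lemma poissonk_den (e a x : R) : 0 < e -> 0 < e ^+ 2 + (x - a) ^+ 2.
Proof. by move=> e0; rewrite ltr_pwDl ?sqr_ge0// exprn_gt0. Qed.

Lemma poissonk_ge0 (e a x : R) : 0 < e -> 0 <= poissonk e a x.
Proof. by move=> e0; rewrite divr_ge0 ?ltW// poissonk_den. Qed.

Lemma continuous_poissonk (e a : R) : 0 < e -> continuous (poissonk e a).
Proof.
move=> e0 x; apply: cvgM; first exact: cvg_cst.
apply: cvgV; first by rewrite gt_eqF// poissonk_den.
apply: cvgD; first exact: cvg_cst.
apply: (@continuous_comp _ _ _ (fun x => x - a) (fun x => x ^+ 2)).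
  by apply: cvgB; [exact: cvg_id|exact: cvg_cst].
exact: exprn_continuous.
Qed.

Lemma integral_oneDsqr : (\int[mu]_x ((oneDsqr x)^-1)%:E = pi%:E)%E.
Proof.
rewrite ge0_symfun_integralT.
- rewrite -set_itvcy integral0y_oneDsqr -EFinM; congr EFin.
  by field.
- by move=> x; rewrite invr_ge0 (le_trans ler01)// oneDsqr_ge1.
- exact: continuous_oneDsqrV.
- by move=> x /=; rewrite /oneDsqr sqrrN.
Qed.

Lemma integral_poissonk (e a : R) : 0 < e ->
  (\int[mu]_x (poissonk e a x)%:E = pi%:E)%E.
Proof.
move=> e0; rewrite -integral_oneDsqr.
pose F x := e^-1 * (x - a).
have dF (x : R) : is_derive x 1 F e^-1.
  by apply: is_derive_eq; rewrite /GRing.scale/=; ring.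
have dFE : derive1 F = cst e^-1 by apply/funext => x; rewrite derive1E derive_val.
rewrite [RHS](@increasing_ge0_integration_by_substitutionT _ F).
- apply: eq_integral => x _; congr EFin.
  rewrite dFE /= /poissonk /oneDsqr /F.
  have h := poissonk_den e a x e0; have h2 : 0 < 1 + (e^-1 * (x - a)) ^+ 2.
    by rewrite ltr_pwDl ?sqr_ge0.
  have := gt_eqF h2; have := gt_eqF h; have := gt_eqF e0 => e1 h1 h3.
  change (e / (e ^+ 2 + (x - a) ^+ 2) = (1 + (e^-1 * (x - a)) ^+ 2)^-1 * e^-1).
  have -> : (1 + (e^-1 * (x - a)) ^+ 2) = (e ^+ 2 + (x - a) ^+ 2) / e ^+ 2.
    by field; rewrite e1.
  by field; rewrite e1 h1.
- by move=> x y xy; rewrite /F ltr_pM2l ?invr_gt0// ltrD2r.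
- by rewrite dFE => x; exact: cvg_cst.
- by rewrite dFE; exact: is_cvg_cst.
- by rewrite dFE; exact: is_cvg_cst.
- by move=> x; case: (dF x).
- apply: gt0_cvgMrNy; first by rewrite invr_gt0.
  exact: cvg_addrr_Ny.
- apply: gt0_cvgMry; first by rewrite invr_gt0.
  by apply: cvg_addrr.
- exact: continuous_oneDsqrV.
- by move=> x; rewrite invr_ge0 (le_trans ler01)// oneDsqr_ge1.
Qed.

Lemma integrable_poissonk (e a : R) : 0 < e ->
  mu.-integrable [set: R] (EFin \o poissonk e a).
Proof.
move=> e0; apply/integrableP; split.
  by apply/measurable_EFinP; apply: continuous_measurable_fun; exact: continuous_poissonk.
under eq_integral do rewrite gee0_abs ?lee_fin ?poissonk_ge0//.
by rewrite integral_poissonk// ltry.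
Qed.

Lemma integrableM_bounded (D : set R) (p k : R -> R) : measurable D ->
  mu.-integrable D (EFin \o p) -> measurable_fun D k ->
  (forall x, D x -> `|k x| <= 1) ->
  mu.-integrable D (EFin \o (fun x => p x * k x)).
Proof.
move=> mD ip mk k1; apply: (@le_integrable _ _ _ mu D mD _ (EFin \o p) _ _ ip) => /=; last first.
  by move=> x Dx; rewrite lee_fin normrM ler_piMr// k1.
apply/measurable_EFinP; apply: measurable_funM => //.
by apply/measurable_EFinP; case/integrableP: ip.
Qed.

(** The double integrand is dominated by |p x| |q y|, whose integral factors; so Tonelli gives joint
    integrability although [k] is only bounded. Used with [f] cut to [-n, n], a decaying exponential
    and a cosine. *)
Lemma Rintegral_Fubini_kernel (p q : R -> R) (k : R * R -> R) :
  mu.-integrable [set: R] (EFin \o p) -> mu.-integrable [set: R] (EFin \o q) ->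
  measurable_fun [set: R * R] k -> (forall z, `|k z| <= 1) ->
  \int[mu]_x (p x * \int[mu]_y (q y * k (x, y))) =
  \int[mu]_y (q y * \int[mu]_x (p x * k (x, y))).
Proof.
move=> ip iq mk k1.
have mp : measurable_fun [set: R] p by apply/measurable_EFinP; case/integrableP: ip.
have mq : measurable_fun [set: R] q by apply/measurable_EFinP; case/integrableP: iq.
pose f (z : R * R) := (p z.1 * q z.2 * k z)%:E.
have mf : measurable_fun setT f.
  apply/measurable_EFinP; apply: measurable_funM => //.
  by apply: measurable_funM; apply: measurableT_comp.
have mk1 x : measurable_fun setT (fun y => k (x, y)).
  by apply: measurableT_comp => //; exact: pair1_measurable.
have mk2 y : measurable_fun setT (fun x => k (x, y)).
  by apply: measurableT_comp => //; exact: pair2_measurable.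
have iqk x : mu.-integrable setT (EFin \o (fun y => q y * k (x, y))).
  by apply: integrableM_bounded.
have ipk y : mu.-integrable setT (EFin \o (fun x => p x * k (x, y))).
  by apply: integrableM_bounded.
have intf : (mu \x mu)%E.-integrable setT f.
  apply/integrable12ltyP => //.
  apply: (@le_lt_trans _ _ (\int[mu]_x (`|p x|%:E * \int[mu]_y `|q y|%:E)))%E.
    apply: ge0_le_integral => //.
    - by move=> x _; exact: integral_ge0.
    - apply: (@measurable_fun_fubini_tonelli_F _ _ _ _ R mu (fun z => `|f z|)%E) => //=.
      by apply: (@measurableT_comp _ _ _ _ _ _ abse _ f) => //; exact: mf.
    - apply: emeasurable_funM; last exact: measurable_cst.
      by apply/measurable_EFinP; exact: measurableT_comp.
    - move=> x _; rewrite -ge0_integralZl//; last first.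
        by apply/measurable_EFinP; exact: measurableT_comp.
      apply: ge0_le_integral => //.
      + apply: measurableT_comp => //; apply/measurable_EFinP; apply: measurable_funM; last exact: (mk1 x).
        apply: measurable_funM; last exact: mq.
        by rewrite /=; exact: measurable_cst.
      + apply: emeasurable_funM; first exact: measurable_cst.
        by apply/measurable_EFinP; exact: measurableT_comp.
      + by move=> y _; rewrite /f /= lee_fin !normrM ler_piMr.
  have qfin : (\int[mu]_y `|q y|%:E)%E \is a fin_num.
    by rewrite ge0_fin_numE ?integral_ge0//; case/integrableP: iq.
  rewrite -(fineK qfin).
  rewrite ge0_integralZr//.
  - by rewrite lte_mul_pinfty ?integral_ge0//; [rewrite ge0_fin_numE ?integral_ge0//; case/integrableP: ip|rewrite ltry].
  - by apply/measurable_EFinP; exact: measurableT_comp.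
  - by rewrite lee_fin fine_ge0// integral_ge0.
have E := Fubini intf.
have Zl (c : R) (h : R -> R) : mu.-integrable setT (EFin \o h) ->
    (\int[mu]_x (c * h x)%:E = (c * \int[mu]_x h x)%:E)%E.
  move=> ih; rewrite EFinM fineK; last exact: integrable_fin_num.
  exact: (integralZl measurableT ih c).
apply: (congr1 fine).
transitivity (\int[mu]_x \int[mu]_y f (x, y))%E.
  apply: eq_integral => x _; rewrite -Zl; last exact: iqk.
  by apply: eq_integral => y _; rewrite /f/= mulrA.
rewrite E; apply: eq_integral => y _; rewrite -Zl; last exact: ipk.
by apply: eq_integral => x _; rewrite /f/= mulrA (mulrC (p x)).
Qed.

Lemma EFin_integrableB (D : set R) (f g : R -> R) : measurable D ->
  mu.-integrable D (EFin \o f) -> mu.-integrable D (EFin \o g) ->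
  mu.-integrable D (EFin \o (fun x => f x - g x)).
Proof. by move=> mD hf hg; exact: (integrableB _ hf hg). Qed.

Lemma EFin_integrableD (D : set R) (f g : R -> R) : measurable D ->
  mu.-integrable D (EFin \o f) -> mu.-integrable D (EFin \o g) ->
  mu.-integrable D (EFin \o (fun x => f x + g x)).
Proof. by move=> mD hf hg; exact: (integrableD _ hf hg). Qed.

Lemma EFin_integrableZl (D : set R) (c : R) (f : R -> R) : measurable D ->
  mu.-integrable D (EFin \o f) -> mu.-integrable D (EFin \o (fun x => c * f x)).
Proof. by move=> mD hf; exact: (integrableZl _ c hf). Qed.

(** * Pairings of square-integrable functions *)

Lemma Lfun2_sqr_integrable (g : R -> R) : measurable_fun [set: R] g ->
  mu.-integrable [set: R] (EFin \o (fun x => g x ^+ 2)) -> g \in Lfun mu 2%:E.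
Proof.
move=> mg ig; apply/andP; split; rewrite inE//= /finite_norm unlock.
apply: poweR_lty; case/integrableP: ig => _; apply: le_lt_trans.
rewrite le_eqVlt; apply/orP; left; apply/eqP; apply: eq_integral => x _ /=.
by rewrite powR_mulrn// normrX.
Qed.

Lemma Lfun_measurable (p : \bar R) (g : R -> R) : g \in Lfun mu p ->
  measurable_fun [set: R] g.
Proof. by move=> /sub_Lfun_mfun; rewrite inE. Qed.

Lemma Lfun2M_integrable (f g : R -> R) : f \in Lfun mu 2%:E -> g \in Lfun mu 2%:E ->
  mu.-integrable [set: R] (EFin \o (fun x => f x * g x)).
Proof. by move=> hf hg; apply/Lfun1_integrable; exact: Lfun2_mul_Lfun1. Qed.

(** Hoelder's inequality with exponents 2 and 2; the finite bound [m] also puts [g] in L^2. *)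
Lemma L2_pairing_bound (f g : R -> R) (m : R) :
  f \in Lfun mu 2%:E -> measurable_fun [set: R] g ->
  (Lnorm mu 2%:E (EFin \o g) < m%:E)%E ->
  mu.-integrable [set: R] (EFin \o (fun x => f x * g x)) /\
  `|\int[mu]_x (f x * g x)| <= fine (Lnorm mu 2%:E (EFin \o f)) * m.
Proof.
move=> hf mg gm.
have hg : g \in Lfun mu 2%:E.
  apply/andP; split; rewrite inE//= /finite_norm.
  by rewrite (lt_trans gm)// ltry.
have ifg := Lfun2M_integrable f g hf hg.
split=> //; apply: (le_trans (le_normr_Rintegral _ ifg)) => //.
have Nf : Lnorm mu 2%:E (EFin \o f) \is a fin_num.
  rewrite ge0_fin_numE ?Lnorm_ge0//.
  by have /andP[_] := hf; rewrite inE.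
rewrite -lee_fin EFinM (fineK Nf).
rewrite /Rintegral fineK; last first.
  by apply: integrable_fin_num => //; exact: (integrable_abse ifg).
have := @hoelder _ _ _ mu f g 2 2 (Lfun_measurable _ _ hf) mg.
rewrite Lnorm1 => h; apply: (le_trans (h _ _ _)) => //; first by rewrite [RHS]splitr !div1r.
by rewrite lee_wpmul2l ?Lnorm_ge0// ltW.
Qed.

Lemma cvge0_lt (T : Type) (F : set_system T) {FF : Filter F} (f : T -> \bar R) (m : R) :
  f x @[x --> F] --> 0%E -> 0 < m -> \forall x \near F, (f x < m%:E)%E.
Proof.
by move=> f0 m0; exact: (f0 _ (@nbhs_open_ereal_lt R 0 (fun=> m) m0)).
Qed.

(** Hoelder's inequality applied to [G - Gn n]. Integrability is claimed for large [n] only: [Gn n]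
    is not assumed to be in L^2, it merely gets close to [G]. *)
Lemma L2_pairing_cvg (psi G : R -> R) (Gn : nat -> R -> R) :
  psi \in Lfun mu 2%:E -> G \in Lfun mu 2%:E ->
  (forall n, measurable_fun [set: R] (Gn n)) ->
  Lnorm mu 2%:E (fun x => (G x - Gn n x)%:E) @[n --> \oo] --> 0%E ->
  (\forall n \near \oo, mu.-integrable [set: R] (EFin \o (fun x => psi x * Gn n x))) /\
  \int[mu]_x (psi x * Gn n x) @[n --> \oo] --> \int[mu]_x (psi x * G x).
Proof.
move=> hpsi hG mGn cN.
suff H e : 0 < e -> \forall n \near \oo,
    mu.-integrable [set: R] (EFin \o (fun x => psi x * Gn n x)) /\
    `|\int[mu]_x (psi x * G x) - \int[mu]_x (psi x * Gn n x)| < e.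
  split; first by apply: filterS (H 1 ltr01) => n [].
  by apply/cvgrPdist_lt => e e0; apply: filterS (H e e0) => n [].
move=> e0; set N := fine (Lnorm mu 2%:E (EFin \o psi)).
have N0 : 0 <= N by rewrite fine_ge0// Lnorm_ge0.
pose m := e / (N + 1) / 2.
have m0 : 0 < m by rewrite !divr_gt0// ltr_pwDr.
have : \forall n \near \oo, (Lnorm mu 2%:E (fun x => (G x - Gn n x)%:E) < m%:E)%E.
  exact: cvge0_lt.
apply: filterS => n hn.
have mG := Lfun_measurable _ _ hG.
have [i1 b1] := L2_pairing_bound psi (fun x => G x - Gn n x) m hpsi
  (measurable_funB mG (mGn n)) hn.
have iG := Lfun2M_integrable _ _ hpsi hG.
have i2 : mu.-integrable [set: R] (EFin \o (fun x => psi x * Gn n x)).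
  have -> : (fun x => psi x * Gn n x) =
      (fun x => psi x * G x - psi x * (G x - Gn n x)) by apply/funext => x; ring.
  exact: EFin_integrableB.
split=> //; rewrite -RintegralB//.
have -> : (fun x => psi x * G x - psi x * Gn n x) = (fun x => psi x * (G x - Gn n x)).
  by apply/funext => x; ring.
apply: (le_lt_trans b1); rewrite -/N /m.
rewrite mulrA mulrA ltr_pdivrMr// ltr_pdivrMr ?ltr_pwDr//.
by nra.
Qed.

Lemma Rintegral_trunc_cvg (h : R -> R) : mu.-integrable [set: R] (EFin \o h) ->
  \int[mu]_(x in `[- n%:R, n%:R]) h x @[n --> \oo] --> \int[mu]_x h x.
Proof.
move=> ih.
have mh : measurable_fun [set: R] h by apply/measurable_EFinP; case/integrableP: ih.
apply: fine_cvg; rewrite /Rintegral fineK; last exact: integrable_fin_num.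
under eq_fun do rewrite integral_mkcond.
apply: (@dominated_cvg _ _ _ mu setT _ _ _ (fun x => `|h x|%:E)) => //.
- move=> n; apply/(measurable_restrictT _ _).1 => //.
  by apply: measurable_funTS; apply/measurable_EFinP.
- move=> x _; apply: cvg_near_cst.
  exists (Num.truncn `|x|).+1 => // n /= hn.
  rewrite patchE mem_set//= in_itv/= -ler_norml.
  rewrite (le_trans (ltW (truncnS_gt _)))// ler_nat//.
- exact: (integrable_abse ih).
- move=> n x _; rewrite patchE; case: ifPn => //=.
  by rewrite normr0 lee_fin.
Qed.

Lemma continuous_sinM (z : R) : continuous (fun x : R => sin (z * x)).
Proof.
move=> x; apply: (@continuous_comp _ _ _ (fun x => z * x) sin).
  exact: mulrl_continuous.
exact: continuous_sin.
Qed.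

Lemma continuous_compMr (g : R -> R) (y : R) :
  continuous g -> continuous (fun x : R => g (x * y)).
Proof.
move=> cg x; apply: (@continuous_comp R R R (fun x : R => x * y) g); last exact: cg.
exact: mulrr_continuous.
Qed.

Lemma continuous_compMl (g : R -> R) (y : R) :
  continuous g -> continuous (fun x : R => g (y * x)).
Proof.
move=> cg x; apply: (@continuous_comp R R R (fun x : R => y * x) g); last exact: cg.
exact: mulrl_continuous.
Qed.

Lemma EFin_integrable_patch (D : set R) (f : R -> R) :
  measurable (D : set (measurableTypeR R)) -> mu.-integrable D (EFin \o f) ->
  mu.-integrable [set: R] (EFin \o (f \_ D)).
Proof.
move=> mD hf; have -> : EFin \o (f \_ D) = (EFin \o f) \_ D.
  by apply/funext => x; rewrite /= !patchE; case: ifPn.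
by apply: (integrable_mkcond _ _).1.
Qed.

Lemma Lfun2_trunc_integrable (f : R -> R) (n : nat) : f \in Lfun mu 2%:E ->
  mu.-integrable `[- n%:R, n%:R] (EFin \o f).
Proof.
move=> hf; have mf := Lfun_measurable _ _ hf.
pose D : set R := `[- n%:R, n%:R]%classic.
have h1 : (\1_D : R -> R) \in Lfun mu 2%:E.
  apply: Lfun2_sqr_integrable; first by apply: measurable_indic; exact: measurable_itv.
  have -> : (fun x : R => (\1_D x : R) ^+ 2) = \1_D.
    by apply/funext => x; rewrite indicE; case: (_ \in _); rewrite ?expr1n ?expr0n.
  exact: integrable_indic_itv.
have := Lfun2M_integrable _ _ hf h1 => i1.
apply/(integrable_mkcond _ _).2 => //.
suff <- : (EFin \o (fun x => f x * \1_D x)) = ((EFin \o f) \_ D) by [].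
apply/funext => x; rewrite patchE /= indicE; case: (x \in D); rewrite ?mulr1 ?mulr0//.
Qed.

(** Dominated convergence with bound |f|. It serves to make the truncated transforms measurable in
    [z], as the L^2 pairings require. *)
Lemma continuous_trig_integral (D : set R) (f trig : R -> R) :
  measurable (D : set (measurableTypeR R)) -> mu.-integrable D (EFin \o f) ->
  continuous trig -> (forall x, `|trig x| <= 1) ->
  continuous (fun z => \int[mu]_(x in D) (f x * trig (x * z))).
Proof.
move=> mD i_f ct t1 z.
have mt (y : R) : measurable_fun [set: R] (fun x => trig (x * y)).
  apply: continuous_measurable_fun.
  exact: continuous_compMr.
apply: (@continuity_under_integral R _ _ mu (fun z x => f x * trig (x * z)) D mD
  (z - 1) (z + 1) _ _ (fun x => `|f x|)).
- move=> y _; apply: integrableM_bounded => //.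
  exact: measurable_funTS.
- apply/nearW => x Dx y _; apply: cvgM; first exact: cvg_cst.
  exact: continuous_compMl.
- exact: (integrable_norm i_f).
- by move=> y _; apply/nearW => x Dx; rewrite normrM ler_piMr.
- by rewrite inE/= in_itv/=; apply/andP; split; lra.
Qed.

(** Truncation makes [f] integrable, so Fubini applies once the kernel is written as a Laplace
    transform; cos ((x - a) xi) is then expanded by the addition formula. *)
Lemma poisson_trunc (f : R -> R) (n : nat) (e a : R) : 0 < e ->
  f \in Lfun mu 2%:E ->
  \int[mu]_(x in `[- n%:R, n%:R]) (f x * poissonk e a x) =
  \int[mu]_(xi in `[0, +oo[) (expR (- e * xi) *
    (cos (a * xi) * \int[mu]_(x in `[- n%:R, n%:R]) (f x * cos (x * xi)) +
     sin (a * xi) * \int[mu]_(x in `[- n%:R, n%:R]) (f x * sin (x * xi)))).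
Proof.
move=> e0 hf.
have ifn := Lfun2_trunc_integrable f n hf.
set D : set R := `[- n%:R, n%:R]%classic in ifn *.
set E : set R := `[0, +oo[%classic.
pose q := (fun x => expR (- e * x)) \_ E.
pose k (z : R * R) := cos ((z.1 - a) * z.2).
have ip := EFin_integrable_patch D _ (measurable_itv _) ifn.
have iq := EFin_integrable_patch E _ (measurable_itv _) (integrable_expRN e e0).
have mk : measurable_fun [set: R * R] k.
  apply: measurableT_comp => //.
    by apply: continuous_measurable_fun; exact: continuous_cos.
  apply: measurable_funM => //.
  apply: measurable_funB; first exact: measurable_fst.
  exact: measurable_cst.
have k1 z : `|k z| <= 1 by rewrite ler_norml cos_geN1 cos_le1.
have := Rintegral_Fubini_kernel _ _ k ip iq mk k1.
have -> : \int[mu]_x ((f \_ D) x * \int[mu]_y (q y * k (x, y))) =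
    \int[mu]_(x in D) (f x * poissonk e a x).
  rewrite [RHS]Rintegral_mkcond; apply: eq_Rintegral => x _.
  rewrite !patchE; case: ifPn => xD; last by rewrite mul0r.
  congr (_ * _); rewrite /poissonk -integral_expRN_cos// [RHS]Rintegral_mkcond.
  apply: eq_Rintegral => y _; rewrite /q !patchE.
  by case: ifPn => // _; rewrite mul0r.
move=> ->; rewrite [RHS]Rintegral_mkcond; apply: eq_Rintegral => y _.
rewrite /q !patchE; case: ifPn => yE; last by rewrite mul0r.
congr (_ * _).
have it (trig : R -> R) : continuous trig -> (forall x, -1 <= trig x <= 1) ->
    mu.-integrable D (EFin \o (fun x => f x * trig (x * y))).
  move=> ct t1; apply: integrableM_bounded => //; [exact: measurable_itv| |
    by move=> x _; rewrite ler_norml].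
  apply: measurable_funTS; apply: continuous_measurable_fun.
  exact: continuous_compMr.
have ic := it cos (@continuous_cos R) (fun x => introT andP (conj (cos_geN1 x) (cos_le1 x))).
have is_ := it sin (@continuous_sin R) (fun x => introT andP (conj (sin_geN1 x) (sin_le1 x))).
rewrite -!RintegralZl//; [|exact: measurable_itv..].
have ic2 := EFin_integrableZl D (cos (a * y)) _ (measurable_itv _) ic.
have is2 := EFin_integrableZl D (sin (a * y)) _ (measurable_itv _) is_.
rewrite -(RintegralD _ ic2 is2); last exact: measurable_itv.
rewrite [RHS]Rintegral_mkcond; apply: eq_Rintegral => x _.
rewrite !patchE; case: ifPn => _; last by rewrite mul0r.
by rewrite /k/= mulrBl cosB; ring.
Qed.

Lemma poissonk_le (e a x : R) : 0 < e -> e * poissonk e a x <= 1.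
Proof.
move=> e0; rewrite /poissonk mulrA ler_pdivrMr ?poissonk_den//.
by rewrite mul1r -expr2 lerDl sqr_ge0.
Qed.

(** The kernel is integrable and bounded by 1 / e, hence square-integrable. *)
Lemma poissonk_Lfun2 (e a : R) : 0 < e -> poissonk e a \in Lfun mu 2%:E.
Proof.
move=> e0.
have mP : measurable_fun [set: R] (poissonk e a).
  by apply: continuous_measurable_fun; exact: continuous_poissonk.
apply: Lfun2_sqr_integrable => //.
have -> : (fun x => poissonk e a x ^+ 2) =
    (fun x => e^-1 * (poissonk e a x * (e * poissonk e a x))).
  apply/funext => x; have e1 := gt_eqF e0; rewrite expr2.
  by field; rewrite e1.
apply: EFin_integrableZl => //.
apply: integrableM_bounded => //; first exact: integrable_poissonk.
  by apply: measurable_funM => //; exact: measurable_cst.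
move=> x _; rewrite ger0_norm ?poissonk_le//.
by rewrite mulr_ge0 ?poissonk_ge0 ?ltW.
Qed.

Lemma expRN_trig_Lfun2 (e a : R) (trig : R -> R) : 0 < e ->
  continuous trig -> (forall x, `|trig x| <= 1) ->
  ((fun x => expR (- e * x) * trig (a * x)) \_ `[0, +oo[) \in Lfun mu 2%:E.
Proof.
move=> e0 ct t1.
set E : set R := `[0, +oo[%classic.
have mt : measurable_fun [set: R] (fun x => trig (a * x)).
  by apply: continuous_measurable_fun; exact: continuous_compMl.
apply: Lfun2_sqr_integrable.
  apply/(measurable_restrictT _ _).1; first exact: measurable_itv.
  apply: measurable_funTS; apply: measurable_funM => //.
  by apply: continuous_measurable_fun; exact: continuous_expRM.
have e2 : 0 < e + e by rewrite addr_gt0.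
have i2 := EFin_integrable_patch E _ (measurable_itv _) (integrable_expRN (e + e) e2).
have -> : (fun x : R => ((fun x => expR (- e * x) * trig (a * x)) \_ E) x ^+ 2) =
    (fun x => ((fun x => expR (- (e + e) * x)) \_ E) x * (trig (a * x) * trig (a * x))).
  apply/funext => x; rewrite !patchE; case: ifPn => _.
    by rewrite opprD mulrDl expRD; ring.
  by rewrite mul0r expr0n.
apply: integrableM_bounded => //; first exact: measurable_funM.
by move=> x _; rewrite normrM -[leRHS]mulr1 ler_pM.
Qed.

(** Let n tend to infinity in [poisson_trunc]: on the left, f times the kernel is integrable; on the
    right, the truncated transforms converge in L^2 and are tested against damped cosines and sines,
    which the damping puts in L^2. *)
Lemma poisson_fourier (f : R -> R) (F : R -> R * R) (e a : R) : 0 < e ->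
  is_fourier f F ->
  \int[mu]_x (f x * poissonk e a x) =
  \int[mu]_(xi in `[0, +oo[) (expR (- e * xi) *
    (cos (a * xi) * (F xi).1 + sin (a * xi) * (F xi).2)).
Proof.
move=> e0 [hf hF1 hF2 hc hd].
set E : set R := `[0, +oo[%classic.
have t1c (x : R) : `|cos x| <= 1 by rewrite ler_norml cos_geN1 cos_le1.
have t1s (x : R) : `|sin x| <= 1 by rewrite ler_norml sin_geN1 sin_le1.
have hpc := expRN_trig_Lfun2 e a cos e0 (@continuous_cos R) t1c.
have hps := expRN_trig_Lfun2 e a sin e0 (@continuous_sin R) t1s.
set pc := (X in X \in _) in hpc; set ps := (X in X \in _) in hps.
have mt n (trig : R -> R) : continuous trig -> (forall x, `|trig x| <= 1) ->
    measurable_fun [set: R] (fun xi => \int[mu]_(x in `[- n%:R, n%:R]) (f x * trig (x * xi))).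
  move=> ct tt1; apply: continuous_measurable_fun.
  exact: (continuous_trig_integral _ f trig (measurable_itv _)
    (Lfun2_trunc_integrable f n hf) ct tt1).
have [ic cc] := L2_pairing_cvg pc _ _ hpc hF1 (fun n => mt n cos (@continuous_cos R) t1c) hc.
have [id cd] := L2_pairing_cvg ps _ _ hps hF2 (fun n => mt n sin (@continuous_sin R) t1s) hd.
have ifP : mu.-integrable [set: R] (EFin \o (fun x => f x * poissonk e a x)).
  by apply: Lfun2M_integrable => //; exact: poissonk_Lfun2.
have c1 := Rintegral_trunc_cvg _ ifP.
have ipF1 := Lfun2M_integrable _ _ hpc hF1.
have ipF2 := Lfun2M_integrable _ _ hps hF2.
have split (u v : R -> R) : mu.-integrable [set: R] (EFin \o (fun x => pc x * u x)) ->
    mu.-integrable [set: R] (EFin \o (fun x => ps x * v x)) ->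
    \int[mu]_x (pc x * u x) + \int[mu]_x (ps x * v x) =
    \int[mu]_(xi in E) (expR (- e * xi) * (cos (a * xi) * u xi + sin (a * xi) * v xi)).
  move=> iu iv; rewrite -RintegralD// [RHS]Rintegral_mkcond.
  apply: eq_Rintegral => x _; rewrite /pc /ps !patchE.
  by case: ifPn => _; [ring|rewrite !mul0r addr0].
rewrite -split//.
apply: (cvg_unique _ c1 _) => //.
apply: cvg_trans (cvgD cc cd).
apply: near_eq_cvg.
near=> n.
by rewrite poisson_trunc//; apply: split; near: n.
Unshelve. all: end_near. Qed.

(** With z = (x - a)^2 >= d^2, one has e / (e^2 + z) <= e / z and 1 / z <= (1 + d^(-2)) / (1 + z).
    So the tail of the kernel is at most [e] times a fixed multiple of the kernel of height 1. *)
Lemma poissonk_far (e d a x : R) : 0 < e -> 0 < d -> d <= `|x - a| ->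
  poissonk e a x <= e * (1 + (d ^+ 2)^-1) * poissonk 1 a x.
Proof.
move=> e0 d0 dx; have d1 := poissonk_den e a x e0; have d2 := poissonk_den 1 a x ltr01.
rewrite expr1n in d2; rewrite /poissonk expr1n mul1r -mulrA ler_pM2l// ler_pdivlMr//.
rewrite mulrC ler_pdivrMr//.
have : d ^+ 2 <= (x - a) ^+ 2 by rewrite -[leRHS]real_normK ?num_real// lerXn2r// nnegrE ltW.
set z := (x - a) ^+ 2; move=> dz; have d20 : 0 < d ^+ 2 by rewrite exprn_gt0.
have : 1 <= (d ^+ 2)^-1 * z by rewrite mulrC ler_pdivlMr// mul1r.
have : 0 <= (d ^+ 2)^-1 by rewrite invr_ge0 ltW.
by have := sqr_ge0 e; set w := e ^+ 2; set v := _^-1; nra.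
Qed.

(** Integrability against the kernel of height 1 takes the place of boundedness of [g]: within
    distance [d] of [a] continuity is used, and beyond it [poissonk_far] bounds the error by [e]
    times a fixed integral. *)
Lemma poisson_approx (g : R -> R) (a : R) : continuous g ->
  mu.-integrable [set: R] (EFin \o (fun x => g x * poissonk 1 a x)) ->
  \int[mu]_x (g x * poissonk n.+1%:R^-1 a x) @[n --> \oo] --> pi * g a.
Proof.
move=> cg ig.
have mg : measurable_fun [set: R] g by exact: continuous_measurable_fun.
have i1 : mu.-integrable [set: R] (EFin \o (fun x => (g x - g a) * poissonk 1 a x)).
  have -> : (fun x => (g x - g a) * poissonk 1 a x) =
      (fun x => g x * poissonk 1 a x - g a * poissonk 1 a x) by apply/funext => x; ring.
  apply: EFin_integrableB => //; apply: EFin_integrableZl => //.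
  exact: integrable_poissonk.
have i1n := integrable_norm i1.
pose I := \int[mu]_x `|(g x - g a) * poissonk 1 a x|.
have I0 : 0 <= I by exact: Rintegral_ge0.
apply/cvgrPdist_le => eta eta0.
(* The kernel has mass pi, so the part near [a] contributes at most eta' pi <= eta / 2. *)
pose eta' := eta / 2 / (pi + 1).
have pi0 : 0 < pi :> R by exact: pi_gt0.
have eta'0 : 0 < eta' by rewrite !divr_gt0// addr_gt0.
have := cg a; move/cvgrPdist_lt => /(_ _ eta'0) [d /= d0 hd].
pose C := 1 + (d ^+ 2)^-1.
have C0 : 0 < C by rewrite ltr_pwDl// invr_ge0 ltW// exprn_gt0.
near=> n.
set e : R := n.+1%:R^-1.
have e0 : 0 < e by rewrite invr_gt0 ltr0n.
have e1 : e <= 1 by rewrite invf_le1 ?ltr0n// ler1n.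
have hbound x : `|(g x - g a) * poissonk e a x| <=
    eta' * poissonk e a x + e * C * `|(g x - g a) * poissonk 1 a x|.
  rewrite !(normrM (g x - g a)) (ger0_norm (poissonk_ge0 _ _ _ e0)) (ger0_norm (poissonk_ge0 _ _ _ ltr01)).
  have P0 := poissonk_ge0 e a x e0; have P1 := poissonk_ge0 1 a x ltr01.
  have [dx|dx] := ltP `|x - a| d.
    rewrite -[leLHS]addr0 lerD//.
      by rewrite ler_wpM2r// distrC ltW// hd//= distrC.
    by apply: mulr_ge0; [exact: mulr_ge0 (ltW e0) (ltW C0)|exact: mulr_ge0 (normr_ge0 _) P1].
  rewrite -[leLHS]add0r lerD//; first exact: mulr_ge0 (ltW eta'0) P0.
  by rewrite [leRHS]mulrCA; apply: ler_wpM2l => //; exact: poissonk_far.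
have ie : mu.-integrable [set: R] (EFin \o (fun x => (g x - g a) * poissonk e a x)).
  apply: (@le_integrable _ _ _ mu setT measurableT _
    (EFin \o (fun x => eta' * poissonk e a x + e * C * `|(g x - g a) * poissonk 1 a x|))).
  - apply/measurable_EFinP; apply: measurable_funM.
      by apply: measurable_funB => //; exact: measurable_cst.
    by apply: continuous_measurable_fun; exact: continuous_poissonk.
  - by move=> x _ /=; rewrite lee_fin (le_trans (hbound x))// ler_norm.
  - apply: EFin_integrableD => //; apply: EFin_integrableZl => //.
    exact: integrable_poissonk.
have ige : mu.-integrable [set: R] (EFin \o (fun x => g a * poissonk e a x)).
  by apply: EFin_integrableZl => //; exact: integrable_poissonk.
have -> : \int[mu]_x (g x * poissonk e a x) =
    \int[mu]_x ((g x - g a) * poissonk e a x) + pi * g a.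
  have -> : pi * g a = \int[mu]_x (g a * poissonk e a x).
    rewrite RintegralZl//; last exact: integrable_poissonk.
    by rewrite /Rintegral integral_poissonk// mulrC.
  rewrite -RintegralD//; apply: eq_Rintegral => x _; ring.
rewrite opprD addrCA subrr addr0 normrN.
apply: (le_trans (le_normr_Rintegral _ ie)) => //.
apply: (@le_trans _ _ (\int[mu]_x (eta' * poissonk e a x + e * C * `|(g x - g a) * poissonk 1 a x|))).
  apply: le_Rintegral => //.
  - exact: (integrable_norm ie).
  - apply: EFin_integrableD => //; apply: EFin_integrableZl => //.
    exact: integrable_poissonk.
rewrite RintegralD//; last 2 first.
  by apply: EFin_integrableZl => //; exact: integrable_poissonk.
  by apply: EFin_integrableZl.
have iP := integrable_poissonk e a e0.
rewrite (RintegralZl _ measurableT iP) (RintegralZl _ measurableT i1n).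
rewrite {1}/Rintegral integral_poissonk//= -/I.
have h1 : eta' * pi <= eta / 2.
  have -> : eta' * pi = (eta / 2) * (pi / (pi + 1)) by rewrite /eta'; ring.
  have p1 : 0 < pi + 1 :> R := addr_gt0 pi0 ltr01.
  have pi1 : pi / (pi + 1) <= 1 :> R.
   by rewrite (ler_pdivrMr _ _ p1) mul1r lerDl.
  by apply: ler_piMr => //; rewrite divr_ge0 ?ltW.
have h2 : e * C * I <= eta / 2.
  have -> : e * C * I = I * C / n.+1%:R by rewrite /e; ring.
  rewrite ler_pdivrMr ?ltr0n// -ler_pdivrMl ?divr_gt0//.
  apply: (@le_trans _ _ n%:R); last by rewrite ler_nat.
  by near: n; apply: filterS (nbhs_infty_gtr ((eta / 2)^-1 * (I * C))) => n /ltW.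
by rewrite [leRHS]splitr lerD.
Unshelve. all: end_near. Qed.

Lemma ae_lebesgueS (P Q : R -> Prop) : (forall x, P x -> Q x) ->
  {ae mu, forall x, P x} -> {ae mu, forall x, Q x}.
Proof.
have F := @ae_filter_ringOfSetsType _ _ R mu.
by move=> PQ; apply: filterS.
Qed.

Lemma ae_integrable (f g : R -> R) : {ae mu, forall x, f x = g x} ->
  mu.-integrable [set: R] (EFin \o f) -> measurable_fun [set: R] g ->
  mu.-integrable [set: R] (EFin \o g).
Proof.
move=> fg /integrableP[mf fi] mg; apply/integrableP; split.
  exact/measurable_EFinP.
rewrite (le_lt_trans _ fi)// le_eqVlt; apply/orP; left; apply/eqP.
apply: ge0_ae_eq_integral => //.
- by apply: measurableT_comp => //; apply/measurable_EFinP.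
- exact: measurableT_comp.
- by apply: ae_lebesgueS fg => x fgx _ /=; rewrite fgx.
Qed.

Lemma ae_Rintegral (f g : R -> R) : {ae mu, forall x, f x = g x} ->
  measurable_fun [set: R] f -> measurable_fun [set: R] g ->
  \int[mu]_x f x = \int[mu]_x g x.
Proof.
move=> fg mf mg; congr fine; apply: ae_eq_integral => //.
- exact/measurable_EFinP.
- exact/measurable_EFinP.
- by apply: ae_lebesgueS fg => x fgx _ /=; rewrite fgx.
Qed.

(** Let e = 1 / (n + 1) tend to 0 in [poisson_fourier]: the left side converges by [poisson_approx],
    since [f] and [g] have the same integrals, and the right side by dominated convergence. For real
    [f] the integrand is even in xi, whence the half-line and the constant pi. *)
Lemma fourier_inversion (f g : R -> R) (F : R -> R * R) (a : R) :
  is_fourier f F -> {ae mu, forall x, f x = g x} -> continuous g ->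
  mu.-integrable `[0, +oo[ (EFin \o (fun xi => (F xi).1)) ->
  mu.-integrable `[0, +oo[ (EFin \o (fun xi => (F xi).2)) ->
  pi * g a =
  \int[mu]_(xi in `[0, +oo[) (cos (a * xi) * (F xi).1 + sin (a * xi) * (F xi).2).
Proof.
move=> hF fg cg i1 i2.
set E : set R := `[0, +oo[%classic.
have [hf hF1 hF2 _ _] := hF.
have mf := Lfun_measurable _ _ hf.
have mF1 := Lfun_measurable _ _ hF1.
have mF2 := Lfun_measurable _ _ hF2.
have mg : measurable_fun [set: R] g by exact: continuous_measurable_fun.
have mP e : 0 < e -> measurable_fun [set: R] (poissonk e a).
  by move=> e0; apply: continuous_measurable_fun; exact: continuous_poissonk.
have fgP e : {ae mu, forall x, f x * poissonk e a x = g x * poissonk e a x}.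
  by apply: ae_lebesgueS fg => x ->.
have igP : mu.-integrable [set: R] (EFin \o (fun x => g x * poissonk 1 a x)).
  apply: (ae_integrable _ _ (fgP 1)); last by apply: measurable_funM => //; exact: mP.
  by apply: Lfun2M_integrable => //; exact: poissonk_Lfun2.
have c1 := poisson_approx g a cg igP.
pose G xi := cos (a * xi) * (F xi).1 + sin (a * xi) * (F xi).2.
have mG : measurable_fun [set: R] G.
  apply: measurable_funD; apply: measurable_funM => //; apply: continuous_measurable_fun.
    exact: continuous_cosM.
  exact: continuous_sinM.
have me n : measurable_fun [set: R] (fun xi => expR (- (n.+1%:R^-1 : R) * xi)).
  by apply: continuous_measurable_fun; exact: continuous_expRM.
have iF := EFin_integrableD E _ _ (measurable_itv _) (integrable_norm i1) (integrable_norm i2).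
have Gle xi : `|G xi| <= `|(F xi).1| + `|(F xi).2|.
  rewrite (le_trans (ler_normD _ _))// !normrM lerD// ler_piMl//.
    by rewrite ler_norml cos_geN1 cos_le1.
  by rewrite ler_norml sin_geN1 sin_le1.
have iG : mu.-integrable E (EFin \o G).
  apply: (@le_integrable _ _ _ mu E (measurable_itv _) _ _ _ _ iF).
    by apply/measurable_EFinP; exact: measurable_funTS.
  by move=> x _ /=; rewrite lee_fin (le_trans (Gle x))// ler_norm.
have c2 : \int[mu]_(xi in E) (expR (- (n.+1%:R^-1) * xi) * G xi) @[n --> \oo] -->
    \int[mu]_(xi in E) G xi.
  apply: fine_cvg; rewrite /Rintegral fineK; last by apply: integrable_fin_num => //; exact: measurable_itv.
  apply: (@dominated_cvg _ _ _ mu E (measurable_itv _) _ _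
    (fun xi => (`|(F xi).1| + `|(F xi).2|)%:E)) => //.
  - move=> n; apply/measurable_EFinP; apply: measurable_funTS.
    by apply: measurable_funM; [exact: me|exact: mG].
  - move=> xi _; apply: cvg_EFin; first exact: nearW.
    rewrite -[X in _ --> X]mul1r -[X in X * _]expR0; apply: cvgM; last exact: cvg_cst.
    apply: (@cvg_comp _ _ _ (fun n : nat => - (n.+1%:R^-1) * xi) expR); last exact: continuous_expR.
    suff : - (n.+1%:R^-1 : R) * xi @[n --> \oo] --> (0 : R) by [].
    rewrite -[X in _ --> X](mul0r xi); apply: cvgMr_tmp.
    rewrite -[X in _ --> X]oppr0; apply: cvgN.
    exact: cvg_harmonic.
  - move=> n xi /=; rewrite /E /= in_itv/= andbT => xi0.
    rewrite lee_fin normrM (ger0_norm (expR_ge0 _)).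
    apply: le_trans (Gle xi); rewrite ler_piMl// -expR0 ler_expR mulNr oppr_le0.
    by rewrite mulr_ge0// invr_ge0.
apply: (cvg_unique _ c1) => //.
apply: cvg_trans c2.
apply: near_eq_cvg; apply: nearW => n.
have n0 : 0 < n.+1%:R^-1 :> R by rewrite invr_gt0 ltr0n.
rewrite -(poisson_fourier f F _ a n0 hF).
apply: ae_Rintegral; first exact: fgP.
  by apply: measurable_funM => //; exact: mP.
by apply: measurable_funM => //; exact: mP.
Qed.
End FourierInversion.

(** * Sobolev embedding *)

Section SobolevEmbedding.
Context {R : realType}.
Notation mu := (@lebesgue_measure R).

Lemma ln1D_cvgy : ln (1 + x : R) @[x --> +oo] --> +oo.
Proof.
apply/cvgryPge => A; near=> x.
have x0 : 0 <= x by near: x; exact: nbhs_pinfty_ge.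
rewrite -(expRK A) ler_ln ?posrE ?expR_gt0//; last by rewrite ltr_pwDl.
rewrite -[leLHS]add0r lerD//.
Unshelve. all: end_near. Qed.

Lemma is_derive_expR_ln1D (p x : R) : 0 <= x ->
  is_derive x 1 (fun y => expR (p * ln (1 + y))) (p * expR ((p - 1) * ln (1 + x))).
Proof.
move=> x0; have x1 : 0 < 1 + x by rewrite ltr_pwDl.
have dl : is_derive x 1 (fun y => ln (1 + y)) (1 + x)^-1.
  have h := @is_derive1_ln R (1 + x) x1.
  have h2 : is_derive x 1 (fun y : R => 1 + y) 1.
    have -> : (fun y : R => 1 + y) = shift 1 by apply/funext => y; rewrite /shift addrC.
    exact: is_derive_shift.
  by have := is_derive1_comp h h2; rewrite mulr1.
apply: is_derive_eq; rewrite /GRing.scale /=.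
rewrite mulrBl mul1r expRB lnK ?posrE//; ring.
Qed.

(** The function is (1 + x)^(- p), written with exp and ln so that its primitive and the limit of
    that primitive at infinity come from the rules for exp. *)
Lemma integrable_expR_ln1D (p : R) : 1 < p ->
  mu.-integrable `[0%R, +oo[ (EFin \o (fun x => expR (- p * ln (1 + x)))).
Proof.
move=> p1.
pose f (x : R) := expR (- p * ln (1 + x)).
pose F x : R := (- (p - 1))^-1 * expR (- (p - 1) * ln (1 + x)).
have p0 : p - 1 != 0 by rewrite subr_eq0 gt_eqF.
have dF (x : R) : 0 <= x -> is_derive x 1 F (f x).
  move=> x0; have := is_derive_expR_ln1D (- (p - 1)) x x0 => h.
  apply: is_derive_eq; rewrite /GRing.scale /=.
  rewrite mulrA mulVf ?oppr_eq0// mul1r /f.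
  by have -> : - (p - 1) - 1 = - p by ring.
have df (x : R) : 0 <= x -> {for x, continuous f}.
  by move=> x0; apply/differentiable_continuous/derivable1_diffP;
    case: (is_derive_expR_ln1D (- p) x x0).
have cF (x : R) : 0 <= x -> {for x, continuous F}.
  by move=> x0; apply/differentiable_continuous/derivable1_diffP; case: (dF x x0).
have wf : {within `[0, +oo[, continuous f}.
  apply: continuous_in_subspaceT => x; rewrite inE /= in_itv/= andbT => x0.
  exact: df.
have mf : measurable_fun (`[0%R, +oo[%classic : set R) f.
  by apply: subspace_continuous_measurable_fun => //; exact: measurable_itv.
apply/integrableP; split; first exact/measurable_EFinP.
under eq_integral do rewrite gee0_abs ?lee_fin ?expR_ge0//.
suff -> : (\int[mu]_(x in `[0%R, +oo[) (f x)%:E = 0%:E - (F 0)%:E)%E by rewrite ltry.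
apply: ge0_continuous_FTC2y.
- by move=> x _; exact: expR_ge0.
- exact: wf.
- rewrite -[X in _ --> X](mulr0 (- (p - 1))^-1); apply: cvgMl_tmp.
  apply: (@cvg_comp _ _ _ (fun x : R => ln (1 + x)) (fun y => expR (- (p - 1) * y))).
    exact: ln1D_cvgy.
  by apply: expRN_cvgy; rewrite subr_gt0.
- by move=> x x0; case: (dF x (ltW x0)).
- exact/cvg_at_right_filter/cF.
- move=> x; rewrite in_itv/= andbT => x0; have := dF x (ltW x0) => h.
  by rewrite derive1E; exact: derive_val.
Qed.

(** With r = s - m > 1/2, the square is at most (1 + xi^2)^(- r) <= 2^r (1 + xi)^(- 2 r), because 2
    (1 + xi^2) - (1 + xi)^2 = (1 - xi)^2; and 2 r > 1. *)
Lemma sobolev_weight_Lfun2 (s : R) (m : nat) : m%:R + 2^-1 < s ->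
  ((fun xi : R => xi ^+ m * (1 + xi ^+ 2) `^ (- (s / 2))) \_ `[0, +oo[) \in Lfun mu 2%:E.
Proof.
move=> ms.
set E : set R := `[0, +oo[%classic.
have mw : measurable_fun [set: R] (fun xi : R => xi ^+ m * (1 + xi ^+ 2) `^ (- (s / 2))).
  apply: measurable_funM; first by apply: measurable_funX; exact: measurable_id.
  apply: (@measurableT_comp _ _ _ _ _ _ (fun x : R => x `^ (- (s / 2)))) => //.
  apply: measurable_funD; first exact: measurable_cst.
  by apply: measurable_funX; exact: measurable_id.
apply: Lfun2_sqr_integrable.
  apply/(measurable_restrictT _ _).1; first exact: measurable_itv.
  exact: measurable_funTS.
pose r := s - m%:R.
have r1 : 1 < 2 * r by rewrite /r; lra.
have ir := EFin_integrable_patch E _ (measurable_itv _) (integrable_expR_ln1D (2 * r) r1).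
have i2 := EFin_integrableZl setT (2 `^ r) _ measurableT ir.
apply: (@le_integrable _ _ _ mu setT measurableT _ _ _ _ i2).
  apply/measurable_EFinP; apply: measurable_funX.
  apply/(measurable_restrictT _ _).1; first exact: measurable_itv.
  exact: measurable_funTS.
move=> x _; rewrite lee_fin /= !patchE; case: ifPn => xE; last first.
  by rewrite expr0n mulr0.
have x0 : 0 <= x by move: xE; rewrite inE /E/= in_itv/= andbT.
have d0 : 0 < 1 + x ^+ 2 by rewrite ltr_pwDl// sqr_ge0.
have x1 : 0 < 1 + x by rewrite ltr_pwDl.
rewrite ger0_norm ?sqr_ge0// ger0_norm ?mulr_ge0 ?powR_ge0 ?expR_ge0//.
rewrite exprMn -exprM mulnC exprM.
have -> : ((1 + x ^+ 2) `^ (- (s / 2))) ^+ 2 = (1 + x ^+ 2) `^ (- s).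
  rewrite -powR_mulrn ?powR_ge0// -powRrM; congr (_ `^ _).
  by field.
have h1 : (x ^+ 2) ^+ m <= (1 + x ^+ 2) `^ m%:R.
  rewrite (powR_mulrn _ (ltW d0)).
  by apply: lerXn2r; rewrite ?nnegrE ?sqr_ge0 ?(ltW d0)// lerDr.
apply: (@le_trans _ _ ((1 + x ^+ 2) `^ m%:R * (1 + x ^+ 2) `^ (- s))).
  by rewrite ler_wpM2r ?powR_ge0.
rewrite -powRD; last by rewrite (gt_eqF d0) implybT.
have -> : m%:R - s = - r by rewrite /r; ring.
have -> : expR (- (2 * r) * ln (1 + x)) = ((1 + x) ^+ 2) `^ (- r).
  rewrite -(powR_mulrn _ (ltW x1)) -powRrM /powR gt_eqF//.
  by have -> : - (2 * r) = 2%:R * - r by rewrite mulrN.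
rewrite !powRN ler_pdivlMr ?powR_gt0 ?exprn_gt0// mulrC ler_pdivrMr ?powR_gt0//.
have -> : 2 `^ r * (1 + x ^+ 2) `^ r = (2 * (1 + x ^+ 2)) `^ r by rewrite powRM// ltW.
apply: ge0_ler_powR.
- by rewrite /r; lra.
- by rewrite nnegrE sqr_ge0.
- by rewrite nnegrE mulr_ge0// ltW.
- by have := sqr_ge0 (1 - x); rewrite !expr2; lra.
Qed.

Definition fourier_mod (F : R -> R * R) (xi : R) : R :=
  Num.sqrt ((F xi).1 ^+ 2 + (F xi).2 ^+ 2).

Lemma fourier_mod_ge0 F xi : 0 <= fourier_mod F xi. Proof. exact: sqrtr_ge0. Qed.

Lemma fourier_mod_ge_cos F xi : `|(F xi).1| <= fourier_mod F xi.
Proof. by rewrite /fourier_mod -sqrtr_sqr ler_wsqrtr// lerDl sqr_ge0. Qed.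

Lemma fourier_mod_ge_sin F xi : `|(F xi).2| <= fourier_mod F xi.
Proof. by rewrite /fourier_mod -sqrtr_sqr ler_wsqrtr// lerDr sqr_ge0. Qed.

Lemma measurable_fourier_mod (f : R -> R) F : is_fourier f F -> measurable_fun [set: R] (fourier_mod F).
Proof.
move=> [_ /Lfun_measurable m1 /Lfun_measurable m2 _ _].
apply: (@measurableT_comp _ _ _ _ _ _ (@Num.sqrt R)) => //.
  by apply: continuous_measurable_fun; exact: sqrt_continuous.
by apply: measurable_funD; apply: measurable_funX.
Qed.

(** Cauchy-Schwarz after splitting xi^m |f^| into xi^m (1 + xi^2)^(- s/2) and (1 + xi^2)^(s/2) |f^|.
    The cases m = 0 and m = 1 serve for f and f'. *)
Lemma sobolev_L1 (s : R) (m : nat) : m%:R + 2^-1 < s ->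
  exists C : R, 0 < C /\ forall (f : R -> R) F (eta : R), is_fourier f F ->
    (Lnorm mu 2%:E (fun xi => ((1 + xi ^+ 2) `^ (s / 2) * fourier_mod F xi)%:E) < eta%:E)%E ->
    mu.-integrable `[0, +oo[ (EFin \o (fun xi => xi ^+ m * fourier_mod F xi)) /\
    \int[mu]_(xi in `[0, +oo[) (xi ^+ m * fourier_mod F xi) <= C * eta.
Proof.
move=> ms; have hw := sobolev_weight_Lfun2 s m ms.
set E : set R := `[0, +oo[%classic.
set w := (X in X \in _) in hw.
pose C := fine (Lnorm mu 2%:E (EFin \o w)).
have C0 : 0 <= C by rewrite fine_ge0// Lnorm_ge0.
(* Adding 1 gives a positive constant without showing that the norm of the weight is nonzero. *)
exists (C + 1); split; first by rewrite ltr_pwDr.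
move=> f F eta hF hN.
have mN := measurable_fourier_mod f F hF.
have mW : measurable_fun [set: R] (fun xi : R => (1 + xi ^+ 2) `^ (s / 2) * fourier_mod F xi).
  apply: measurable_funM => //.
  apply: (@measurableT_comp _ _ _ _ _ _ (fun x : R => x `^ (s / 2))) => //.
  apply: measurable_funD; first exact: measurable_cst.
  by apply: measurable_funX; exact: measurable_id.
have [i1 b1] := L2_pairing_bound w _ eta hw mW hN.
have wE : (fun xi : R => w xi * ((1 + xi ^+ 2) `^ (s / 2) * fourier_mod F xi)) =
    (fun xi => xi ^+ m * fourier_mod F xi) \_ E.
  apply/funext => xi; rewrite /w !patchE; case: ifPn => _; last by rewrite mul0r.
  have d0 : 0 < 1 + xi ^+ 2 by rewrite ltr_pwDl// sqr_ge0.
  rewrite mulrA -(mulrA (xi ^+ m)) powRN mulVf ?mulr1//.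
  by rewrite gt_eqF// powR_gt0.
rewrite wE in i1 b1.
have eta0 : 0 <= eta.
  by rewrite -lee_fin; apply: le_trans (ltW hN); exact: Lnorm_ge0.
split.
  apply/(integrable_mkcond _ _).2; first exact: measurable_itv.
  rewrite -/E in i1 *.
  suff <- : EFin \o ((fun xi => xi ^+ m * fourier_mod F xi) \_ E) =
    (EFin \o (fun xi => xi ^+ m * fourier_mod F xi)) \_ E by [].
  by apply/funext => x; rewrite /= !patchE; case: ifPn.
rewrite Rintegral_mkcond (le_trans (ler_norm _))// (le_trans b1)//.
by rewrite -/C ler_wpM2r// lerDl.
Qed.

(** The norm being an infimum, a strict upper bound produces an actual transform; hence the strict
    bounds [eta] in the embeddings. *)
Lemma sobolev_norm_lt (s eta : R) (f : R -> R) : (sobolev_norm s f < eta%:E)%E ->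
  exists F, is_fourier f F /\
    (Lnorm mu 2%:E (fun xi => ((1 + xi ^+ 2) `^ (s / 2) * fourier_mod F xi)%:E) < eta%:E)%E.
Proof. by move=> /ereal_inf_lt [_ [F hF <-] h]; exists F. Qed.

Lemma integrable_dominated (D : set R) (f h : R -> R) :
  measurable (D : set (measurableTypeR R)) -> measurable_fun D f ->
  (forall x, D x -> `|f x| <= h x) ->
  mu.-integrable D (EFin \o h) -> mu.-integrable D (EFin \o f).
Proof.
move=> mD mf fh ih; apply: (@le_integrable _ _ _ mu D mD _ _ _ _ ih).
  exact/measurable_EFinP.
by move=> x Dx /=; rewrite lee_fin (le_trans (fh x Dx))// ler_norm.
Qed.

(** [f] is allowed to differ from the continuous [g] on a null set because it will be applied to a
    difference quotient in time minus the time derivative, of which only the class is known. *)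
Lemma sobolev_sup (s : R) : 2^-1 < s -> exists C : R, 0 < C /\
  forall (f g : R -> R) (eta : R), {ae mu, forall x, f x = g x} -> continuous g ->
    (sobolev_norm s f < eta%:E)%E -> forall x, `|g x| <= C * eta.
Proof.
move=> s1; have s1' : 0%:R + 2^-1 < s by rewrite add0r.
have [C [C0 hC]] := sobolev_L1 s 0 s1'.
(* The 2 is from |cos F1 + sin F2| <= 2 |f^|, and 1 / pi from the inversion formula. *)
exists (2 * C / pi); split.
  by rewrite divr_gt0 ?pi_gt0// mulr_gt0.
move=> f g eta fg cg /sobolev_norm_lt [F [hF hN]] x.
have [i0 b0] := hC f F eta hF hN.
set E : set R := `[0, +oo[%classic in i0 b0.
have N1 xi : xi ^+ 0 * fourier_mod F xi = fourier_mod F xi by rewrite expr0 mul1r.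
have [_ /Lfun_measurable m1 /Lfun_measurable m2 _ _] := hF.
have iN : mu.-integrable E (EFin \o fourier_mod F).
  by apply: (integrable_dominated _ _ _ (measurable_itv _) _ _ i0);
    [apply: measurable_funTS; exact: (measurable_fourier_mod _ _ hF)|
     move=> xi _; rewrite N1 ger0_norm// fourier_mod_ge0].
have i1 : mu.-integrable E (EFin \o (fun xi => (F xi).1)).
  apply: (integrable_dominated _ _ _ (measurable_itv _) _ _ iN).
    exact: measurable_funTS.
  by move=> xi _; exact: fourier_mod_ge_cos.
have i2 : mu.-integrable E (EFin \o (fun xi => (F xi).2)).
  apply: (integrable_dominated _ _ _ (measurable_itv _) _ _ iN).
    exact: measurable_funTS.
  by move=> xi _; exact: fourier_mod_ge_sin.
have inv := fourier_inversion f g F x hF fg cg i1 i2.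
rewrite mulrAC ler_pdivlMr ?pi_gt0// mulrC -[X in X * _]ger0_norm ?pi_ge0// -normrM inv.
have Kle xi : `|cos (x * xi) * (F xi).1 + sin (x * xi) * (F xi).2| <= 2 * fourier_mod F xi.
  rewrite (le_trans (ler_normD _ _))// !normrM mulr2n mulrDl mul1r lerD//.
    by rewrite -[leRHS]mul1r ler_pM// ?fourier_mod_ge_cos// ler_norml cos_geN1 cos_le1.
  by rewrite -[leRHS]mul1r ler_pM// ?fourier_mod_ge_sin// ler_norml sin_geN1 sin_le1.
have i2N := EFin_integrableZl E 2 _ (measurable_itv _) iN.
have iK : mu.-integrable E (EFin \o
    (fun xi => cos (x * xi) * (F xi).1 + sin (x * xi) * (F xi).2)).
  apply: (integrable_dominated _ _ _ (measurable_itv _) _ _ i2N) => //.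
  apply: measurable_funTS; apply: measurable_funD; apply: measurable_funM => //;
    apply: continuous_measurable_fun; [exact: continuous_cosM|exact: continuous_sinM].
rewrite -/E; apply: (le_trans (le_normr_Rintegral _ iK)); first exact: measurable_itv.
apply: (@le_trans _ _ (\int[mu]_(xi in E) (2 * fourier_mod F xi))).
  by apply: le_Rintegral => //; [exact: measurable_itv|exact: (integrable_norm iK)].
rewrite RintegralZl; [|exact: measurable_itv|exact: iN].
rewrite -mulrA ler_wpM2l//.
by rewrite (le_trans _ b0)// le_eqVlt; apply/orP; left; apply/eqP; apply: eq_Rintegral => xi _; rewrite N1.
Qed.

(** The inversion formula is differentiated under the integral sign: the differentiated integrand is
    dominated by 2 xi |f^|, integrable since s > 3/2. *)
Lemma sobolev_sup_C1 (s : R) : 3 / 2 < s -> exists C : R, 0 < C /\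
  forall (f : R -> R) (eta : R), continuous f -> (sobolev_norm s f < eta%:E)%E ->
    [/\ forall x, derivable f x 1, continuous (derive1 f),
        forall x, `|f x| <= C * eta & forall x, `|derive1 f x| <= C * eta].
Proof.
move=> s1; have s0 : 2^-1 < s by lra.
have s1' : 1%:R + 2^-1 < s by lra.
have s0' : 0%:R + 2^-1 < s by lra.
have [C0 [C00 hC0]] := sobolev_sup s s0.
have [C [C_gt0 hC]] := sobolev_L1 s 1 s1'.
have [C' [_ hC']] := sobolev_L1 s 0 s0'.
(* One constant for both bounds: [C0] serves for f and 2 C / pi for f'. *)
pose D := C0 + 2 * C / pi.
have D2 : 0 <= 2 * C / pi by rewrite divr_ge0 ?pi_ge0// mulr_ge0// ltW.
exists D; split; first by rewrite ltr_pwDl.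
move=> f eta cf hf.
have eta0 : 0 <= eta.
  have [F [_ h]] := sobolev_norm_lt _ _ _ hf.
  by rewrite -lee_fin; apply: le_trans (ltW h); exact: Lnorm_ge0.
have ff : {ae mu, forall x, f x = f x}.
  have FF := @ae_filter_ringOfSetsType _ _ R mu.
  exact: nearW.
have b0 x : `|f x| <= D * eta.
  rewrite (le_trans (hC0 f f eta ff cf hf x))// ler_wpM2r// lerDl//.
have [F [hF hN]] := sobolev_norm_lt _ _ _ hf.
have [i1 b1] := hC f F eta hF hN.
have [i0 _] := hC' f F eta hF hN.
set E : set R := `[0, +oo[%classic in i0 i1 b1.
have mE : measurable (E : set (measurableTypeR R)) by exact: measurable_itv.
have [_ /Lfun_measurable m1 /Lfun_measurable m2 _ _] := hF.
have mN := measurable_fourier_mod _ _ hF.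
have iN : mu.-integrable E (EFin \o fourier_mod F).
  by apply: (integrable_dominated _ _ _ mE _ _ i0);
    [exact: measurable_funTS|move=> xi _; rewrite expr0 mul1r ger0_norm// fourier_mod_ge0].
have iF1 : mu.-integrable E (EFin \o (fun xi => (F xi).1)).
  apply: (integrable_dominated _ _ _ mE _ _ iN); first exact: measurable_funTS.
  by move=> xi _; exact: fourier_mod_ge_cos.
have iF2 : mu.-integrable E (EFin \o (fun xi => (F xi).2)).
  apply: (integrable_dominated _ _ _ mE _ _ iN); first exact: measurable_funTS.
  by move=> xi _; exact: fourier_mod_ge_sin.
pose K (a xi : R) := cos (a * xi) * (F xi).1 + sin (a * xi) * (F xi).2.
pose K1 (a xi : R) := xi * (cos (a * xi) * (F xi).2 - sin (a * xi) * (F xi).1).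
have fK : f = fun a => pi^-1 * \int[mu]_(xi in E) K a xi.
  apply/funext => a; rewrite -(fourier_inversion f f F a hF ff cf iF1 iF2).
  by rewrite mulKf// gt_eqF// pi_gt0.
have dK (a xi : R) : is_derive a 1 (fun a => K a xi) (K1 a xi).
  by apply: is_derive_eq; rewrite /GRing.scale /= /K1; ring.
have mc a : measurable_fun [set: R] (fun xi : R => cos (a * xi)).
  by apply: continuous_measurable_fun; exact: continuous_cosM.
have ms a : measurable_fun [set: R] (fun xi : R => sin (a * xi)).
  by apply: continuous_measurable_fun; exact: continuous_sinM.
have mK a : measurable_fun [set: R] (K a).
  by apply: measurable_funD; apply: measurable_funM.
have mK1 a : measurable_fun [set: R] (K1 a).
  apply: measurable_funM => //.
  by apply: measurable_funB; apply: measurable_funM.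
have c1 x : `|cos x| <= 1 :> R by rewrite ler_norml cos_geN1 cos_le1.
have n1 x : `|sin x| <= 1 :> R by rewrite ler_norml sin_geN1 sin_le1.
have Kle a xi : `|K a xi| <= 2 * fourier_mod F xi.
  rewrite (le_trans (ler_normD _ _))// !normrM mulr2n mulrDl mul1r lerD//.
    by rewrite -[leRHS]mul1r ler_pM// fourier_mod_ge_cos.
  by rewrite -[leRHS]mul1r ler_pM// fourier_mod_ge_sin.
have K1le a xi : E xi -> `|K1 a xi| <= 2 * (xi ^+ 1 * fourier_mod F xi).
  rewrite /E/= in_itv/= andbT => xi0; rewrite mulrCA normrM expr1 ger0_norm// ler_wpM2l//.
  rewrite (le_trans (ler_normB _ _))// !normrM mulr2n mulrDl mul1r lerD//.
    by rewrite -[leRHS]mul1r ler_pM// fourier_mod_ge_sin.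
  by rewrite -[leRHS]mul1r ler_pM// fourier_mod_ge_cos.
have i2N := EFin_integrableZl E 2 _ mE iN.
have i2N1 := EFin_integrableZl E 2 _ mE i1.
have iK a : mu.-integrable E (EFin \o K a).
  by apply: (integrable_dominated _ _ _ mE _ _ i2N) => //; exact: measurable_funTS.
have iK1 a : mu.-integrable E (EFin \o K1 a).
  apply: (integrable_dominated _ _ _ mE _ _ i2N1); first exact: measurable_funTS.
  by move=> xi Exi; exact: K1le.
pose G xi := `|2 * (xi ^+ 1 * fourier_mod F xi)|.
have iG : mu.-integrable E (EFin \o G) := integrable_norm i2N1.
have aI (a : R) : `]a - 1, a + 1[%classic a.
  by rewrite /= in_itv/=; apply/andP; split; lra.
have p1E a : partial1of2 K a = K1 a.
  by apply/funext => xi; rewrite partial1of2E; exact: derive_val.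
have dK' (x y : R) : derivable (K ^~ y) x 1 by case: (dK x y).
have G_ub (a x y : R) : `]a - 1, a + 1[%classic x -> E y -> `|partial1of2 K x y| <= G y.
  by move=> _ Ey; rewrite p1E (le_trans (K1le _ _ Ey))// ler_norm.
have derK (a : R) : is_derive a 1 (fun a => \int[mu]_(xi in E) K a xi)
    (\int[mu]_(xi in E) K1 a xi).
  have d := @derivable_under_integral R _ _ mu K E mE a _ _ (aI a) (fun x _ => iK x)
    (fun x y _ _ => dK' x y) G (fun y => normr_ge0 _) iG (G_ub a).
  have v := @differentiation_under_integral R _ _ mu K E mE a _ _ (aI a) (fun x _ => iK x)
    (fun x y _ _ => dK' x y) G (fun y => normr_ge0 _) iG (G_ub a).
  by apply: DeriveDef => //; rewrite -derive1E v p1E.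
have derf (a : R) : is_derive a 1 f (pi^-1 * \int[mu]_(xi in E) K1 a xi).
  by rewrite fK; have := derK a => h; apply: is_derive_eq.
have f'E : derive1 f = fun a => pi^-1 * \int[mu]_(xi in E) K1 a xi.
  by apply/funext => a; rewrite derive1E; have := derf a => h; exact: derive_val.
split.
- by move=> x; case: (derf x).
- rewrite f'E => a; apply: cvgMl_tmp.
  apply: (@continuity_under_integral R _ _ mu K1 E mE (a - 1) (a + 1) _ _ G iG).
  + by move=> x _; exact: iK1.
  + have FF := @ae_filter_ringOfSetsType _ _ R mu.
    apply: nearW => xi _ x _; apply: cvgMl_tmp; apply: cvgB; apply: cvgMr_tmp.
      exact: (continuous_compMr cos xi (@continuous_cos R)).
    exact: (continuous_compMr sin xi (@continuous_sin R)).
  + move=> x _; have FF := @ae_filter_ringOfSetsType _ _ R mu.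
    by apply: nearW => xi Exi; rewrite (le_trans (K1le _ _ Exi))// ler_norm.
  + by rewrite inE; exact: aI.
- exact: b0.
- move=> x; rewrite f'E normrM ger0_norm ?invr_ge0 ?pi_ge0//.
  apply: (@le_trans _ _ (pi^-1 * (2 * (C * eta)))); last first.
    have -> : pi^-1 * (2 * (C * eta)) = (2 * C / pi) * eta by ring.
    by rewrite ler_wpM2r// lerDr ltW.
  rewrite ler_wpM2l ?invr_ge0 ?pi_ge0//.
  apply: (le_trans (le_normr_Rintegral _ (iK1 x))); first exact: measurable_itv.
  apply: (@le_trans _ _ (\int[mu]_(xi in E) (2 * (xi ^+ 1 * fourier_mod F xi)))).
    by apply: le_Rintegral => //; [exact: (integrable_norm (iK1 x))|move=> xi; exact: K1le].
  rewrite RintegralZl; [|exact: measurable_itv|exact: i1].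
  by rewrite ler_wpM2l.
Qed.
End SobolevEmbedding.

(** * Convolution with the Green function *)

Section ExpKernel.
Context {R : realType}.
Notation mu := (@lebesgue_measure R).

Lemma continuous_expRNnorm (e x : R) : continuous (fun y : R => expR (- e * `|x - y|)).
Proof.
move=> y.
apply: (@continuous_comp R R R (fun y => `|x - y|) (fun z => expR (- e * z))).
  apply: (@continuous_comp R R R (fun y => x - y) (fun z => `|z|)); last exact: norm_continuous.
  by apply: cvgB; [exact: cvg_cst|exact: cvg_id].
exact: continuous_expRM.
Qed.

Lemma integral_expRNnorm (e x : R) : 0 < e ->
  (\int[mu]_y (expR (- e * `|x - y|))%:E = (2 / e)%:E)%E.
Proof.
move=> e0.
have h0 : (\int[mu]_y (expR (- e * `|y|))%:E = (2 / e)%:E)%E.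
  rewrite ge0_symfun_integralT.
  - rewrite -set_itvcy EFinM -(integral_expRN e e0); congr (_ * _)%E.
    apply: eq_integral => y; rewrite inE /= in_itv/= andbT => y0.
    by rewrite ger0_norm.
  - by move=> y; exact: expR_ge0.
  - move=> y; have := continuous_expRNnorm e 0 y.
    by under eq_fun do rewrite sub0r normrN.
  - by move=> y /=; rewrite normrN.
rewrite -h0; pose F := shift (- x) : R -> R.
have dF (y : R) : is_derive y 1 F 1 by exact: is_derive_shift.
have dFE : derive1 F = cst 1 by apply/funext => y; rewrite derive1E derive_val.
rewrite [RHS](@increasing_ge0_integration_by_substitutionT _ F).
- apply: eq_integral => y _; congr EFin.
  rewrite dFE /F; transitivity (expR (- e * `|y - x|) * 1) => //.
  by rewrite mulr1 distrC.
- by move=> y z yz; rewrite /F /shift ltrD2r.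
- by rewrite dFE => y; exact: cvg_cst.
- by rewrite dFE; exact: is_cvg_cst.
- by rewrite dFE; exact: is_cvg_cst.
- by move=> y; case: (dF y).
- exact: cvg_addrr_Ny.
- exact: cvg_addrr.
- move=> y; have := continuous_expRNnorm e 0 y.
  by under eq_fun do rewrite sub0r normrN.
- by move=> y; exact: expR_ge0.
Qed.

Lemma integrable_expRNnorm (e x : R) : 0 < e ->
  mu.-integrable [set: R] (EFin \o (fun y => expR (- e * `|x - y|))).
Proof.
move=> e0; apply/integrableP; split.
  apply/measurable_EFinP; apply: continuous_measurable_fun.
  exact: continuous_expRNnorm.
under eq_integral do rewrite gee0_abs ?lee_fin ?expR_ge0//.
by rewrite /= integral_expRNnorm// ltry.
Qed.

Lemma integrable_expRNnormM (x B : R) (f : R -> R) : continuous f ->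
  (forall y, `|f y| <= B) ->
  mu.-integrable [set: R] (EFin \o (fun y => expR (- `|x - y|) * f y)).
Proof.
move=> cf fB.
have i1 := EFin_integrableZl setT B _ measurableT (integrable_expRNnorm 1 x ltr01).
apply: (integrable_dominated _ _ _ measurableT _ _ i1).
  apply: continuous_measurable_fun => y; apply: cvgM; last exact: cf.
  by have := continuous_expRNnorm 1 x y; under eq_fun do rewrite mulN1r.
move=> y _; rewrite normrM (ger0_norm (expR_ge0 _)) mulN1r mulrC ler_wpM2r ?expR_ge0//.
Qed.

End ExpKernel.

Section Lambda.
Context {R : realType}.
Notation mu := (@lebesgue_measure R).

(* The two halves of 2 Lambda^(-2) f; the derivative of Lambda^(-2) f is half
   their difference. *)
Definition exp_left (f : R -> R) (x : R) : R :=
  \int[mu]_(y in `]-oo, x]) (expR (- `|x - y|) * f y).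
Definition exp_right (f : R -> R) (x : R) : R :=
  \int[mu]_(y in `[x, +oo[) (expR (- `|x - y|) * f y).

Section bounded.
Variables (f : R -> R) (B : R).
Hypothesis cf : continuous f.
Hypothesis fB : forall y, `|f y| <= B.

Let iK (D : set R) (x : R) : measurable (D : set (measurableTypeR R)) ->
  mu.-integrable D (EFin \o (fun y => expR (- `|x - y|) * f y)).
Proof.
move=> mD; apply: (@integrableS _ _ _ mu setT D) => //.
exact: (integrable_expRNnormM x B f).
Qed.

Lemma Lambda_m2E (x : R) : Lambda_m2 f x = (exp_left f x + exp_right f x) / 2.
Proof.
rewrite /Lambda_m2.
under eq_Rintegral do rewrite mulrAC mulrC.
rewrite RintegralZl//; last exact: iK.
rewrite mulrC; congr (_ / _).
rewrite /exp_right -Rintegral_itv_obnd_cbnd; last by apply: iK; exact: measurable_itv.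
have U : [set: R] = `]-oo, x]%classic `|` `]x, +oo[%classic.
  apply/seteqP; split=> [y _|y _ //] /=; rewrite !in_itv/= andbT.
  by case: (leP y x) => h; [left|right].
rewrite U Rintegral_setU; first by [].
- exact: measurable_itv.
- exact: measurable_itv.
- by rewrite -U; exact: iK.
apply/disj_setPS => y /= []; rewrite !in_itv/= andbT => yx xy.
by move: (le_lt_trans yx xy); rewrite ltxx.
Qed.

(** On a half-line ending at x, with e = 1 or e = -1, the kernel e^(- |x - y|) is a constant times
    e^(e y). *)
Let iexp (e : R) (D : set R) : measurable (D : set (measurableTypeR R)) ->
  (exists x, D `<=` [set y | e * (x - y) = `|x - y|]) ->
  mu.-integrable D (EFin \o (fun y => expR (e * y) * f y)).
Proof.
move=> mD [x Dx]; have i1 := EFin_integrableZl D (expR (e * x)) _ mD (iK D x mD).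
apply: (@eq_integrable _ _ _ mu D mD _ _ _ i1) => y; rewrite inE => /Dx /= h.
by rewrite -h mulrA -expRD; congr (EFin (expR _ * _)); ring.
Qed.

(** On the left half-line the kernel splits, so that the function is e^(- x) times the integral of
    e^y f(y) up to x: product rule and fundamental theorem of calculus. *)
Lemma is_derive_exp_left (x : R) : is_derive x 1 (exp_left f) (f x - exp_left f x).
Proof.
pose h y := expR (1 * y) * f y.
have ih (z : R) : mu.-integrable `]-oo, z] (EFin \o h).
  apply: iexp; first exact: measurable_itv.
  exists z => y /=; rewrite in_itv/= => yz.
  by rewrite mul1r ger0_norm// subr_ge0.
have hE (z : R) : exp_left f z = expR (- z) * \int[mu]_(y in `]-oo, z]) h y.
  rewrite /exp_left -RintegralZl; [|exact: measurable_itv|exact: ih].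
  apply: eq_Rintegral => y; rewrite inE/= in_itv/= => yz.
  by rewrite /h mulrA -expRD ger0_norm ?subr_ge0//; congr (expR _ * _); ring.
have ch : {for x, continuous h}.
  by apply: cvgM; [exact: continuous_expRM|exact: cf].
have x1 : x < x + 1 by rewrite ltrDl.
have FTC := continuous_FTC1 x1 (ih (x + 1)).
have [d v] := FTC (ltNyr x) ch.
have dI : is_derive x 1 (fun z => \int[mu]_(y in `]-oo, z]) h y) (h x).
  by apply: DeriveDef; [exact: d|rewrite -derive1E; exact: v].
have -> : exp_left f = fun z => expR (- z) * \int[mu]_(y in `]-oo, z]) h y.
  exact/funext.
apply: is_derive_eq; rewrite /GRing.scale /= /h mul1r.
rewrite mulrA -expRD addNr expR0 mul1r; ring.
Qed.

(** As for [exp_left], except that the moving bound is the lower one: near x the tail integral is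
    written as a constant minus an integral from x - 1 to the moving point. *)
Lemma is_derive_exp_right (x : R) : is_derive x 1 (exp_right f) (exp_right f x - f x).
Proof.
pose h y := expR (-1 * y) * f y.
have ih (z : R) : mu.-integrable `[z, +oo[ (EFin \o h).
  apply: iexp; first exact: measurable_itv.
  exists z => y /=; rewrite in_itv/= andbT => yz.
  by rewrite mulN1r ler0_norm// subr_le0.
pose a := x - 1; pose I := \int[mu]_(y in `[a, +oo[) h y.
have iha (z : R) : mu.-integrable `[a, z] (EFin \o h).
  apply: (@integrableS _ _ _ mu `[a, +oo[%classic _ _ (measurable_itv _) (measurable_itv _) _ (ih a)).
  by move=> y /=; rewrite !in_itv/= andbT => /andP[].
have hE (z : R) : a <= z -> exp_right f z = expR z * (I - \int[mu]_(y in `[a, z]) h y).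
  move=> az.
  have -> : I - \int[mu]_(y in `[a, z]) h y = \int[mu]_(y in `[z, +oo[) h y.
    have U : `[a, +oo[%classic = `[a, z]%classic `|` `]z, +oo[%classic.
      apply/seteqP; split=> y /=; rewrite !in_itv/= !andbT.
        by move=> ay; case: (leP y z) => zy; [left; rewrite ay|right].
      by case=> [/andP[]//|zy]; exact: (le_trans az (ltW zy)).
    have iz : mu.-integrable `]z, +oo[ (EFin \o h).
      apply: (@integrableS _ _ _ mu `[z, +oo[%classic _ _ (measurable_itv _) (measurable_itv _) _ (ih z)).
      by move=> y /=; rewrite !in_itv/= !andbT => /ltW.
    rewrite /I U Rintegral_setU.
    - by rewrite addrAC subrr add0r; exact: Rintegral_itv_obnd_cbnd.
    - exact: measurable_itv.
    - exact: measurable_itv.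
    - by rewrite -U; exact: ih.
    - apply/disj_setPS => y /= []; rewrite !in_itv/= andbT => /andP[_ yz] zy.
      by move: (le_lt_trans yz zy); rewrite ltxx.
  rewrite /exp_right -RintegralZl; [|exact: measurable_itv|exact: ih].
  apply: eq_Rintegral => y; rewrite inE/= in_itv/= andbT => yz.
  by rewrite /h mulrA -expRD ler0_norm ?subr_le0//; congr (expR _ * _); ring.
have ch : {for x, continuous h}.
  by apply: cvgM; [exact: continuous_expRM|exact: cf].
have x1 : x < x + 1 by rewrite ltrDl.
have ax : a < x by rewrite ltrBlDr ltrDl.
have [d v] := @continuous_FTC1_closed R h a x (x + 1) x1 (iha _) ax ch.
have dI : is_derive x 1 (fun z => \int[mu]_(y in `[a, z]) h y) (h x).
  by apply: DeriveDef; [exact: d|rewrite -derive1E; exact: v].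
apply: (@near_eq_is_derive _ _ _ (fun z => expR z * (I - \int[mu]_(y in `[a, z]) h y))).
  near=> z; rewrite hE//; near: z; exact: lt_le_nbhsr.
apply: is_derive_eq; rewrite /GRing.scale /= (hE _ (ltW ax)) /h mulN1r.
set J := \int[mu]_(y in _) _.
have e1 : expR x * expR (- x) = 1 by rewrite -expRD subrr expR0.
transitivity (expR x * (I - J) - (expR x * expR (- x)) * f x); first by ring.
by rewrite e1 mul1r.
Unshelve. all: end_near. Qed.

Lemma is_derive_Lambda_m2 (x : R) :
  is_derive x 1 (Lambda_m2 f) ((exp_right f x - exp_left f x) / 2).
Proof.
have -> : Lambda_m2 f = fun x => 2^-1 * (exp_left f x + exp_right f x).
  by apply/funext => y; rewrite Lambda_m2E mulrC.
have dL := is_derive_exp_left x; have dR := is_derive_exp_right x.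
by apply: is_derive_eq; rewrite /GRing.scale /=; field.
Qed.

Lemma derive1_Lambda_m2 : derive1 (Lambda_m2 f) = fun x => (exp_right f x - exp_left f x) / 2.
Proof.
by apply/funext => x; rewrite derive1E; have h := is_derive_Lambda_m2 x; exact: derive_val.
Qed.

(** This is (1 - d^2/dx^2) Lambda^(-2) f = f. Thanks to it the nonlocal terms are differentiable in
    x although their densities involve u_x. *)
Lemma is_derive_derive1_Lambda_m2 (x : R) :
  is_derive x 1 (derive1 (Lambda_m2 f)) (Lambda_m2 f x - f x).
Proof.
have -> : derive1 (Lambda_m2 f) = fun x => 2^-1 * (exp_right f x - exp_left f x).
  by rewrite derive1_Lambda_m2; apply/funext => y; rewrite mulrC.
have dL := is_derive_exp_left x; have dR := is_derive_exp_right x.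
by apply: is_derive_eq; rewrite /GRing.scale /= Lambda_m2E; field.
Qed.

(** The growth condition gives e^(- |x - y|) om y <= e^(- (1 - th) |x - y|) om x, and the last
    exponential has integral 2 / (1 - th). The derivative of the kernel has the same absolute value
    as the kernel, hence the same bound. *)
Lemma Lambda_m2_bound (om : R -> R) (th A x : R) : th < 1 -> 0 <= A -> 0 <= om x ->
  (forall y, om y <= expR (th * `|x - y|) * om x) ->
  (forall y, `|f y| <= A * om y) ->
  `|Lambda_m2 f x| <= A * om x / (1 - th) /\
  `|derive1 (Lambda_m2 f) x| <= A * om x / (1 - th).
Proof.
move=> th1 A0 om0 omle fA.
have e0 : 0 < 1 - th by rewrite subr_gt0.
pose N D := \int[mu]_(y in D) `|expR (- `|x - y|) * f y|.
have mL := measurable_itv `]-oo, x]; have mR := measurable_itv `[x, +oo[.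
have iT := integrable_norm (iK setT x measurableT).
have hL : `|exp_left f x| <= N `]-oo, x]%classic.
  by apply: (le_normr_Rintegral _ (iK _ x mL)).
have hR : `|exp_right f x| <= N `[x, +oo[%classic.
  by apply: (le_normr_Rintegral _ (iK _ x mR)).
have NE : N setT = N `]-oo, x]%classic + N `[x, +oo[%classic.
  have U : [set: R] = `]-oo, x]%classic `|` `]x, +oo[%classic.
    apply/seteqP; split=> [y _|y _ //] /=; rewrite !in_itv/= andbT.
    by case: (leP y x) => h; [left|right].
  rewrite /N [in LHS]U Rintegral_setU.
  - congr (_ + _); apply: Rintegral_itv_obnd_cbnd.
    exact: (integrable_norm (iK _ x (measurable_itv `]x, +oo[))).
  - exact: measurable_itv.
  - exact: measurable_itv.
  - by rewrite -U; exact: iT.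
  - apply/disj_setPS => y /= []; rewrite !in_itv/= andbT => yx xy.
    by move: (le_lt_trans yx xy); rewrite ltxx.
have ie := integrable_expRNnorm (1 - th) x e0.
have NT : N setT <= (A * om x) * (2 / (1 - th)).
  have -> : 2 / (1 - th) = \int[mu]_y expR (- (1 - th) * `|x - y|).
    by rewrite /Rintegral integral_expRNnorm.
  rewrite -(RintegralZl _ measurableT ie).
  apply: le_Rintegral => //; first exact: EFin_integrableZl.
  move=> y _; rewrite normrM (ger0_norm (expR_ge0 _)).
  apply: (@le_trans _ _ (expR (- `|x - y|) * (A * (expR (th * `|x - y|) * om x)))).
    by rewrite ler_wpM2l ?expR_ge0// (le_trans (fA y))// ler_wpM2l.
  have -> : - (1 - th) * `|x - y| = - `|x - y| + th * `|x - y| by ring.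
  by rewrite expRD le_eqVlt; apply/orP; left; apply/eqP; ring.
have NT2 : N setT / 2 <= A * om x / (1 - th).
  have -> : A * om x / (1 - th) = (A * om x) * (2 / (1 - th)) / 2.
    by field; rewrite gt_eqF.
  by rewrite ler_pM2r.
rewrite derive1_Lambda_m2 Lambda_m2E; split; apply: le_trans NT2;
  rewrite normrM [X in _ * X]ger0_norm// ler_pM2r// NE.
  by rewrite (le_trans (ler_normD _ _))// lerD.
by rewrite (le_trans (ler_normB _ _))// addrC lerD.
Qed.
End bounded.

End Lambda.

(** * Classical regularity of the solution *)

(* Cousin's lemma: a transitive relation that holds on all sufficiently short
   intervals around each tag [t] holds on the whole interval. *)
Lemma cousin {R : realType} (P : R -> R -> Prop) (a b : R) : a <= b ->
  (forall x y z, a <= x -> x <= y -> y <= z -> z <= b -> P x y -> P y z -> P x z) ->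
  (forall t, a <= t -> t <= b -> exists2 d, 0 < d &
    forall x y, a <= x -> x <= t -> t <= y -> y <= b -> t - d < x -> y < t + d -> P x y) ->
  P a b.
Proof.
move=> ab Ptrans Ploc.
pose S : set R := [set t | [/\ a <= t, t <= b & P a t]].
have Sa : S a.
  by have [d d0 h] := Ploc a (lexx a) ab; split=> //; apply: h => //; lra.
have ubS : ubound S b by move=> t [].
have hS : has_sup S by split; [exists a|exists b].
pose c := sup S.
have ac : a <= c by apply: sup_upper_bound.
have cb : c <= b by apply: ge_sup => //; exists a.
have [d d0 hd] := Ploc c ac cb.
have [t [at_ tb Pat] ct] := sup_adherent d0 hS.
have tc : t <= c by apply: sup_upper_bound.
have Py y : c <= y -> y <= b -> y < c + d -> P a y.
  move=> cy yb ycd; apply: (Ptrans a t y) => //; first exact: le_trans cy.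
  exact: hd.
case: (ltP c b) => [cltb|bc]; last first.
  have cE : c = b by apply/eqP; rewrite eq_le cb bc.
  by apply: Py; rewrite ?cE// ltrDl.
(* If c < b, the tag c reaches beyond c: then y > c belongs to [S], against the choice of c. *)
pose y := Num.min b (c + d / 2).
have yb : y <= b by rewrite ge_min lexx.
have cy : c < y by rewrite lt_min cltb/= ltrDl divr_gt0.
have : y <= c.
  apply: sup_upper_bound => //; split=> //.
    exact: le_trans (ltW cy).
  apply: Py => //; first exact: ltW.
  by rewrite gt_min; apply/orP; right; lra.
by rewrite leNgt cy.
Qed.

Section ClassicalSolution.
Context {R : realType}.
Notation mu := (@lebesgue_measure R).

Lemma normM_exp_le (a b M : R) (m n : nat) : `|a| <= M -> `|b| <= M ->
  `|a ^+ m * b ^+ n| <= M ^+ m * M ^+ n.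
Proof.
move=> aM bM; have M0 : 0 <= M := le_trans (normr_ge0 a) aM.
by rewrite normrM !normrX ler_pM ?exprn_ge0// lerXn2r ?nnegrE.
Qed.

Lemma continuous_exprM (f g : R -> R) (m n : nat) : continuous f -> continuous g ->
  continuous (fun x => f x ^+ m * g x ^+ n).
Proof.
move=> cf cg x; apply: cvgM.
  apply: (@continuous_comp R R R f (fun y => y ^+ m)); first exact: cf.
  exact: exprn_continuous.
apply: (@continuous_comp R R R g (fun y => y ^+ n)); first exact: cg.
exact: exprn_continuous.
Qed.

Lemma is_derive_continuous (f df : R -> R) :
  (forall x : R, is_derive x 1 f (df x)) -> continuous f.
Proof.
by move=> h x; apply/differentiable_continuous/derivable1_diffP; case: (h x).
Qed.

Lemma continuous_nonlocal_rhs (k : nat) (f : R -> R) (M : R) :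
  continuous f -> continuous (derive1 f) ->
  (forall x, `|f x| <= M) -> (forall x, `|derive1 f x| <= M) ->
  continuous (nonlocal_rhs k f).
Proof.
move=> cf cf' fM f'M x.
have c1 := continuous_exprM f (derive1 f) (k - 2)%N 3 cf cf'.
have c2 := continuous_exprM f (derive1 f) (k - 1)%N 2 cf cf'.
have b1 y := normM_exp_le (f y) (derive1 f y) M (k - 2)%N 3 (fM y) (f'M y).
have b2 y := normM_exp_le (f y) (derive1 f y) M (k - 1)%N 2 (fM y) (f'M y).
apply: cvgB; apply: cvgMl_tmp.
  exact: (is_derive_continuous _ _ (is_derive_Lambda_m2 _ _ c1 b1)).
exact: (is_derive_continuous _ _ (is_derive_derive1_Lambda_m2 _ _ c2 b2)).
Qed.

(** All that is used of the solution after [solution_classical]. Continuity and derivative in time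
    are uniform in x, as sup norms provide; explicit radii make them one-sided at 0 and T0 and fit
    the tags of [cousin]. The time derivative appears only as the value the equation gives it. *)
Record classical_solution (k : nat) (T0 : R) (u : R -> R -> R) : Prop := {
  cs_derivable : forall t, 0 <= t -> t <= T0 -> forall x, derivable (u t) x 1 ;
  cs_continuous : forall t, 0 <= t -> t <= T0 -> continuous (derive1 (u t)) ;
  cs_bounded : exists M, forall t, 0 <= t -> t <= T0 ->
    forall x, `|u t x| <= M /\ `|derive1 (u t) x| <= M ;
  cs_cont_t : forall t0, 0 <= t0 -> t0 <= T0 -> forall e, 0 < e -> exists2 d, 0 < d &
    forall t, 0 <= t -> t <= T0 -> `|t - t0| < d -> forall x,
      `|u t x - u t0 x| <= e /\ `|derive1 (u t) x - derive1 (u t0) x| <= e ;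
  cs_deriv_t : forall t0, 0 <= t0 -> t0 <= T0 -> forall e, 0 < e -> exists2 d, 0 < d &
    forall t, 0 <= t -> t <= T0 -> `|t - t0| < d -> forall x,
      `|u t x - u t0 x - (t - t0) *
         (nonlocal_rhs k (u t0) x - u t0 x ^+ k * derive1 (u t0) x)| <= e * `|t - t0|
}.

Lemma derive1B_fun (f g : R -> R) (x : R) : derivable f x 1 -> derivable g x 1 ->
  derive1 (fun y => f y - g y) x = derive1 f x - derive1 g x.
Proof.
by move=> df dg; rewrite !derive1E; have := deriveB df dg.
Qed.

Lemma near_within_ball (J : set R) (t0 : R) (P : R -> Prop) :
  (\forall t \near within J (nbhs t0), P t) ->
  exists2 d, 0 < d & forall t, J t -> `|t - t0| < d -> P t.
Proof.
move=> /nbhs_ballP [d /= d0 h]; exists d => // t Jt td.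
by apply: h => //; rewrite /ball/= distrC.
Qed.

Lemma near_dwithin_ball (J : set R) (t0 : R) (P : R -> Prop) :
  (\forall t \near within J (t0^'), P t) ->
  exists2 d, 0 < d & forall t, J t -> t != t0 -> `|t - t0| < d -> P t.
Proof.
move=> /nbhs_ballP [d /= d0 h]; exists d => // t Jt tt0 td.
by apply: h => //; rewrite /ball/= distrC.
Qed.

(** The embedding of H^s is applied to u(t) - u(t0), and that of H^(s-1), where s - 1 > 1/2, to the
    difference quotient in time minus [v]. As [v] satisfies the equation only almost everywhere, the
    quotient is compared with the continuous function [G] equal to [v] almost everywhere. The
    uniform bound on [0, T0] is a compactness argument through [cousin]. *)
Lemma solution_classical (k : nat) (s T0 : R) (T : \bar R) (u : R -> R -> R) :
  3 / 2 < s -> 0 < T0 -> (T0%:E < T)%E ->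
  solution k s [set t | 0 <= t /\ (t%:E < T)%E] u -> classical_solution k T0 u.
Proof.
move=> s_gt T00 T0T [cu [uS uC] [v [vC vD eqv]]].
set J := [set t | _] in cu uS uC vC vD eqv.
have JT0 t : 0 <= t -> t <= T0 -> J t.
  by move=> t0 tT; split=> //; apply: le_lt_trans T0T; rewrite lee_fin.
have [C [C0 hC]] := sobolev_sup_C1 s s_gt.
have s1 : 2^-1 < s - 1 by lra.
have [D [D0 hD]] := sobolev_sup (s - 1) s1.
have fin t : J t -> exists M : R, [/\ forall x, derivable (u t) x 1,
    continuous (derive1 (u t)), forall x, `|u t x| <= M & forall x, `|derive1 (u t) x| <= M].
  move=> Jt; have := uS t Jt; rewrite /sobolev => h.
  have [eta heta] : exists eta : R, (sobolev_norm s (u t) < eta%:E)%E.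
    have n0 : (0 <= sobolev_norm s (u t))%E.
      by apply: le_ereal_inf_tmp => _ [F _ <-]; exact: Lnorm_ge0.
    exists (fine (sobolev_norm s (u t)) + 1).
    rewrite EFinD fineK ?ge0_fin_numE// lteDl// ?lte_fin// ge0_fin_numE//.
  by have [d c b1 b2] := hC (u t) eta (cu t Jt) heta; exists (C * eta).
have contt t0 : J t0 -> forall e, 0 < e -> exists2 d, 0 < d &
    forall t, J t -> `|t - t0| < d -> forall x,
      `|u t x - u t0 x| <= e /\ `|derive1 (u t) x - derive1 (u t0) x| <= e.
  move=> Jt0 e e0.
  have eC0 : 0 < e / C by rewrite divr_gt0.
  have [d d0 h] := near_within_ball _ _ _ (cvge0_lt _ _ _ _ (uC t0 Jt0) eC0).
  exists d => // t Jt td x.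
  have [M [dt _ _ _]] := fin t Jt; have [M0 [dt0 _ _ _]] := fin t0 Jt0.
  have cB : continuous (fun x => u t x - u t0 x).
    by move=> y; apply: cvgB; exact: cu.
  have [_ _ b1 b2] := hC _ _ cB (h t Jt td).
  rewrite mulrCA divff ?gt_eqF// mulr1 in b1 b2.
  by split; [exact: b1|rewrite -derive1B_fun; [exact: b2|exact: dt|exact: dt0]].
split.
- by move=> t t0 tT; have [M []] := fin t (JT0 t t0 tT).
- by move=> t t0 tT; have [M []] := fin t (JT0 t t0 tT).
- pose P (x y : R) := exists M, forall t, x <= t -> t <= y ->
    forall x, `|u t x| <= M /\ `|derive1 (u t) x| <= M.
  have [M hM] : P 0 T0.
    apply: cousin; first exact: ltW.
      move=> x y z _ xy yz _ [M hM] [N hN]; exists (Num.max M N) => t xt tz w.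
      case: (leP t y) => ty.
        by have [h1 h2] := hM t xt ty w; rewrite !le_max h1 h2.
      by have [h1 h2] := hN t (ltW ty) tz w; rewrite !le_max h1 h2 !orbT.
    move=> t t0 tT; have Jt := JT0 t t0 tT.
    have [M [_ _ b1 b2]] := fin t Jt.
    have [d d0 h] := contt t Jt 1 ltr01.
    exists d => // x y x0 xt ty yT tdx ytd; exists (M + 1) => r xr ry w.
    have Jr : J r by apply: JT0; [exact: le_trans xr|exact: le_trans yT].
    have rd : `|r - t| < d by rewrite ltr_norml; apply/andP; split; lra.
    have [h1 h2] := h r Jr rd w; split.
      have -> : u r w = u t w + (u r w - u t w) by ring.
      by rewrite (le_trans (ler_normD _ _))// lerD.
    have -> : derive1 (u r) w = derive1 (u t) w + (derive1 (u r) w - derive1 (u t) w) by ring.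
    by rewrite (le_trans (ler_normD _ _))// lerD.
  by exists M.
- move=> t0 t00 tT e e0; have [d d0 h] := contt t0 (JT0 t0 t00 tT) e e0.
  by exists d => // t t1 tT1 td x; apply: h => //; exact: JT0.
- move=> t0 t00 tT e e0; have Jt0 := JT0 t0 t00 tT.
  have eD0 : 0 < e / D by rewrite divr_gt0.
  have [d d0 h] := near_dwithin_ball _ _ _ (cvge0_lt _ _ _ _ (vD t0 Jt0) eD0).
  exists d => // t t1 tT1 td x; have Jt := JT0 t t1 tT1.
  have [->|tt0] := eqVneq t t0.
    by rewrite !subrr mul0r subrr normr0 mulr0.
  have [M [_ c' b1 b2]] := fin t0 Jt0.
  pose G x := nonlocal_rhs k (u t0) x - u t0 x ^+ k * derive1 (u t0) x.
  have cG : continuous G.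
    move=> y; apply: cvgB; first exact: (continuous_nonlocal_rhs k _ _ (cu t0 Jt0) c' b1 b2).
    by have := continuous_exprM (u t0) (derive1 (u t0)) k 1 (cu t0 Jt0) c' y;
      under eq_fun do rewrite expr1.
  have ae : {ae mu, forall x, (u t x - u t0 x) / (t - t0) - v t0 x =
      (u t x - u t0 x) / (t - t0) - G x}.
    by apply: ae_lebesgueS (eqv t0 Jt0) => y hy; rewrite /G -hy; ring.
  have cg : continuous (fun x => (u t x - u t0 x) / (t - t0) - G x).
    move=> y; apply: cvgB; last exact: cG.
    by apply: cvgMr_tmp; apply: cvgB; exact: cu.
  have := hD _ _ _ ae cg (h t Jt tt0 td) x.
  rewrite mulrCA divff ?gt_eqF// mulr1 => b.
  have n0 : t - t0 != 0 by rewrite subr_eq0.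
  have -> : u t x - u t0 x - (t - t0) *
      (nonlocal_rhs k (u t0) x - u t0 x ^+ k * derive1 (u t0) x) =
      (t - t0) * ((u t x - u t0 x) / (t - t0) - G x) by rewrite /G; field.
  by rewrite normrM mulrC ler_wpM2r.
Qed.
End ClassicalSolution.

(** * Transport of the space derivative *)

Section Transport.
Context {R : realType}.

Lemma continuous_dist (f : R -> R) (x e : R) : continuous f -> 0 < e ->
  exists2 d, 0 < d & forall y, `|y - x| < d -> `|f y - f x| <= e.
Proof.
move=> cf e0; have := cf x; move/cvgrPdist_le => /(_ e e0) [d /= d0 h].
by exists d => // y yd; rewrite distrC; apply: h; rewrite /= distrC.
Qed.

Lemma heine_cantor (f : R -> R) (a b e : R) : a <= b -> continuous f -> 0 < e ->
  exists2 d, 0 < d & forall y z, a <= y -> y <= b -> a <= z -> z <= b ->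
    `|y - z| < d -> `|f y - f z| <= e.
Proof.
move=> ab cf e0; have e20 : 0 < e / 2 by rewrite divr_gt0.
pose P a b := exists2 d, 0 < d & forall y z, a <= y -> y <= b -> a <= z -> z <= b ->
    y <= z -> z < y + d -> `|f y - f z| <= e.
suff [d d0 h] : P a b.
  exists d => // y z ay yb az zb; rewrite ltr_norml => /andP[h1 h2].
  case: (leP y z) => yz; first by apply: h => //; lra.
  by rewrite distrC; apply: h => //; [exact: ltW|lra].
apply: cousin => //.
  move=> x y z _ xy yz _ [d1 d10 h1] [d2 d20 h2].
  (* Continuity at the common endpoint [y] handles the pairs of points on either side of it. *)
  have [d3 d30 h3] := continuous_dist f y _ cf e20.
  exists (Num.min d1 (Num.min d2 d3)); first by rewrite !lt_min d10 d20 d30.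
  move=> p q xp pz xq qz pq qpd.
  have qp1 : q < p + d1 by apply: (lt_le_trans qpd); rewrite lerD2l ge_min lexx.
  have qp2 : q < p + d2 by apply: (lt_le_trans qpd); rewrite lerD2l !ge_min lexx orbT.
  have qp3 : q < p + d3 by apply: (lt_le_trans qpd); rewrite lerD2l !ge_min lexx !orbT.
  case: (leP q y) => qy; first by apply: h1 => //; exact: le_trans qy.
  case: (leP y p) => py; first by apply: h2 => //; exact: ltW.
  have -> : f p - f q = (f p - f y) - (f q - f y) by ring.
  rewrite (le_trans (ler_normB _ _))// [leRHS]splitr lerD// h3// ltr_norml; apply/andP; split; lra.
move=> t at_ tb; have [d d0 h] := continuous_dist f t _ cf e20.
exists d => // x y ax xt ty yb tdx ytd; exists 1 => // p q xp py xq qy _ _.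
have -> : f p - f q = (f p - f t) - (f q - f t) by ring.
rewrite (le_trans (ler_normB _ _))// [leRHS]splitr lerD// h// ltr_norml; apply/andP; split; lra.
Qed.

(** The endpoints come in either order, since the displacement - tau u^k has no fixed sign. The
    distances of [c] to both ends are recorded because either may be the point of reference. *)
Lemma MVT_dist (f df : R -> R) (a b : R) : (forall x : R, is_derive x 1 f (df x)) ->
  exists c, [/\ `|c - a| <= `|b - a|, `|c - b| <= `|b - a| & f b - f a = df c * (b - a)].
Proof.
move=> hf; have cf := is_derive_continuous f df hf.
case: (leP a b) => ab.
  have [c + E] := MVT_segment ab (fun x _ => hf x) (continuous_subspaceT cf).
  rewrite in_itv/= => /andP[ac cb]; exists c; split => //.
    by rewrite !ger0_norm ?subr_ge0// lerD2r.
  by rewrite distrC !ger0_norm ?subr_ge0// lerD2l lerN2.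
have [c + E] := MVT_segment (ltW ab) (fun x _ => hf x) (continuous_subspaceT cf).
rewrite in_itv/= => /andP[bc ca]; exists c; split.
- by rewrite distrC (distrC b) !ger0_norm ?subr_ge0 ?(ltW ab)// lerD2l lerN2.
- by rewrite (distrC b) !ger0_norm ?subr_ge0 ?(ltW ab)// lerD2r.
- by rewrite -opprB E -mulrN opprB.
Qed.

Lemma cs_is_derive (k : nat) (T0 : R) u : classical_solution k T0 u ->
  forall t, 0 <= t -> t <= T0 -> forall x : R, is_derive x 1 (u t) (derive1 (u t) x).
Proof.
move=> cs t t0 tT x; have d := cs_derivable _ _ _ cs t t0 tT x.
by apply: DeriveDef => //; rewrite derive1E.
Qed.

Lemma is_derive_quotient (f df : R -> R) (h : R) : (forall x : R, is_derive x 1 f (df x)) ->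
  forall x : R, is_derive x 1 (fun y => (f (y + h) - f y) / h) ((df (x + h) - df x) / h).
Proof.
move=> hf x; have h1 := hf x; have h2 : is_derive x 1 (fun y => f (y + h)) (df (x + h)).
  have := @is_derive1_comp R f (shift h) x _ _ (hf (x + h)) (is_derive_shift x 1 h).
  by rewrite mulr1.
by apply: is_derive_eq; rewrite /GRing.scale /= mulr0 add0r mulrC.
Qed.

(* [A2], [A1] are the values of [u] at [x + h] at the later and earlier time,
   [B2], [B1] those at [x]; [W1], [W0] are the values of [u_x] at the tag time
   and [V1], [V0] those at the earlier time, at the point given by the mean value
   theorem; [b] and [p] are the values of [u ^+ k] at [x] and [x + h]. *)
Lemma transport_step_identity (h tau b p A1 A2 B1 B2 N0 N1 V0 V1 W0 W1 : R) :
  (A2 - B2) / h - ((A1 - B1) / h + (V1 - V0) / h * - (tau * b)) =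
  (tau * (N1 - N0 - (p - b) * W1) + (A2 - A1 - tau * (N1 - p * W1)) -
   (B2 - B1 - tau * (N0 - b * W0)) -
   (tau * b) * ((W1 - V1) - (W0 - V0))) / h.
Proof. by rewrite mulrAC -mulrDl -mulrBl; congr (_ / h); ring. Qed.

(* As [u_xx] need not exist, the characteristics of [u_x] are followed on the
   difference quotient of step [h], which is differentiable in both variables:
   one explicit Euler step moves [x] to [x - tau * u ^+ k], and the steps are
   glued by Cousin's lemma.  Only the backward cone of [x0] is visited. *)
Lemma transport (k : nat) (T0 : R) u (t0 t1 x0 beta rho eta : R) :
  classical_solution k T0 u -> 0 <= t0 -> t0 <= t1 -> t1 <= T0 ->
  0 <= beta -> 0 < eta ->
  (forall t y, t0 <= t -> t <= t1 -> `|y - x0| <= beta * (t1 - t0) ->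
     `|u t y ^+ k| <= beta) ->
  (forall t y h, t0 <= t -> t <= t1 -> `|y - x0| <= beta * (t1 - t0) -> 0 < h -> h <= 1 ->
     `|nonlocal_rhs k (u t) (y + h) - nonlocal_rhs k (u t) y -
       (u t (y + h) ^+ k - u t y ^+ k) * derive1 (u t) (y + h)| <= rho * h) ->
  exists y, `|y - x0| <= beta * (t1 - t0) + eta /\
    `|derive1 (u t1) x0 - derive1 (u t0) y| <= rho * (t1 - t0) + eta.
Proof.
move=> cs t00 t01 t1T b0 eta0 Hb HS.
have T00 : 0 <= T0 by apply: le_trans t1T; exact: le_trans t01.
have t10 : 0 <= t1 by exact: le_trans t01.
have t0T : t0 <= T0 by exact: le_trans t1T.
pose w t := derive1 (u t).
have du t : 0 <= t -> t <= T0 -> forall x : R, is_derive x 1 (u t) (w t x).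
  exact: cs_is_derive cs t.
have cw t (h0 : 0 <= t) (hT : t <= T0) := cs_continuous _ _ _ cs t h0 hT.
have eta20 : 0 < eta / 2 by rewrite divr_gt0.
have [d d0 hd] := continuous_dist (w t1) x0 _ (cw t1 t10 t1T) eta20.
(* [h <= 1] is required by the source hypothesis, [h <= eta] bounds the final displacement, and
   [h < d] lets the quotient at time [t1] replace u_x at x0. *)
pose h := Num.min 1 (Num.min eta (d / 2)).
have h0 : 0 < h by rewrite !lt_min ltr01 eta0 divr_gt0.
have h1 : h <= 1 by rewrite ge_min lexx.
have heta : h <= eta by rewrite !ge_min lexx orbT.
have hd2 : h < d by apply: (@le_lt_trans _ _ (d / 2)); [rewrite !ge_min lexx !orbT|lra].
pose D t x := (u t (x + h) - u t x) / h.
have quot t x : 0 <= t -> t <= T0 -> exists c, `|c - x| <= h /\ D t x = w t c.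
  move=> ht hT; have [c [cx _ E]] := MVT_dist (u t) (w t) x (x + h) (du t ht hT).
  have xh : x + h - x = h by ring.
  rewrite xh (gtr0_norm h0) in cx; exists c; split=> //.
  by rewrite /D E xh mulfK// gt_eqF.
have dD t : 0 <= t -> t <= T0 ->
    forall x : R, is_derive x 1 (D t) ((w t (x + h) - w t x) / h).
  by move=> ht hT; exact: is_derive_quotient (du t ht hT).
pose L := t1 - t0.
have L0 : 0 <= L by rewrite subr_ge0.
(* An error per unit of time; over the whole interval it amounts to at most eta / 2. *)
pose eps := eta / 2 / (L + 1).
have L1 : 0 < L + 1 by rewrite ltr_wpDl.
have eps0 : 0 < eps by rewrite divr_gt0.
(* The admissible [x] at time [b] fill the backward cone of (t1, x0). Its radius grows backwards
   exactly by the distance that a step may travel, so that [Q] composes. *)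
pose Q a b := forall x, `|x - x0| <= beta * (t1 - b) ->
  exists y, `|y - x| <= beta * (b - a) /\ `|D b x - D a y| <= (rho + eps) * (b - a).
have QL : Q t0 t1.
  apply: cousin => //.
    move=> a b c ta ab bc ct1 Qab Qbc x hx.
    have [y [yx Ey]] := Qbc x hx.
    have hy : `|y - x0| <= beta * (t1 - b).
      have -> : y - x0 = (y - x) + (x - x0) by ring.
      rewrite (le_trans (ler_normD _ _))// (le_trans (lerD yx hx))//.
      by rewrite -mulrDr le_eqVlt; apply/orP; left; apply/eqP; ring.
    have [z [zy Ez]] := Qab y hy; exists z; split.
      have -> : z - x = (z - y) + (y - x) by ring.
      rewrite (le_trans (ler_normD _ _))// (le_trans (lerD zy yx))//.
      by rewrite -mulrDr le_eqVlt; apply/orP; left; apply/eqP; ring.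
    have -> : D c x - D a z = (D b y - D a z) + (D c x - D b y) by ring.
    rewrite (le_trans (ler_normD _ _))// (le_trans (lerD Ez Ey))//.
    by rewrite -mulrDr le_eqVlt; apply/orP; left; apply/eqP; ring.
  move=> t tt0 tt1.
  have ht : 0 <= t by exact: le_trans tt0.
  have hT : t <= T0 by exact: le_trans t1T.
  (* A step makes two errors e tau in the expansions in time and four errors tau beta e from the
     oscillation of u_x, all of them divided by [h]; they add up to eps tau. *)
  pose e := eps * h / (2 + 4 * beta).
  have den : 0 < 2 + 4 * beta by clear -b0; lra.
  have e0 : 0 < e by rewrite divr_gt0// mulr_gt0.
  have [d1 d10 H1] := cs_cont_t _ _ _ cs t ht hT e e0.
  have [d2 d20 H2] := cs_deriv_t _ _ _ cs t ht hT e e0.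
  (* The segment contains all points where u_x is compared: the cone has radius beta L, and shifts
     by h <= 1 occur. *)
  pose A := beta * L + 2.
  have bL : 0 <= beta * L by rewrite mulr_ge0.
  have A0 : x0 - A <= x0 + A by rewrite /A; clear -bL; lra.
  have [d3 d30 H3] := heine_cantor (w t) _ _ _ A0 (cw t ht hT) e0.
  have b1 : 0 < beta + 1 by rewrite ltr_wpDl.
  (* A step has length tau < 2 dt, so the last entry gives beta tau < d3. *)
  pose dt := Num.min d1 (Num.min d2 (d3 / (beta + 1) / 2)).
  have dt0 : 0 < dt by rewrite !lt_min d10 d20 !divr_gt0.
  have dt1 : dt <= d1 by rewrite ge_min lexx.
  have dt2 : dt <= d2 by rewrite !ge_min lexx orbT.
  have dt3 : dt <= d3 / (beta + 1) / 2 by rewrite !ge_min lexx !orbT.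
  exists dt => // s1 s2 t0s1 s1t ts2 s2t1 tds1 s2td x hx.
  have s10 : 0 <= s1 by exact: le_trans t0s1.
  have s1T : s1 <= T0 by exact: le_trans hT.
  have s20 : 0 <= s2 by exact: le_trans ts2.
  have s2T : s2 <= T0 by exact: le_trans t1T.
  pose tau := s2 - s1.
  have tau0 : 0 <= tau by rewrite /tau subr_ge0; exact: le_trans ts2.
  have s1d : `|s1 - t| < dt.
    by rewrite ltr_norml; apply/andP; clear -tds1 s1t dt0; split; lra.
  have s2d : `|s2 - t| < dt.
    by rewrite ltr_norml; apply/andP; clear -s2td ts2 dt0; split; lra.
  have xZ : `|x - x0| <= beta * (t1 - t0).
    by rewrite (le_trans hx)// ler_wpM2l// lerD2l lerN2 (le_trans tt0).
  pose b := u t x ^+ k.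
  have bb : `|b| <= beta by apply: Hb.
  have step z : `|u s2 z - u s1 z - tau *
      (nonlocal_rhs k (u t) z - u t z ^+ k * w t z)| <= e * tau.
    set G := nonlocal_rhs k (u t) z - u t z ^+ k * w t z.
    have g2 := H2 s2 s20 s2T (lt_le_trans s2d dt2) z.
    have g1 := H2 s1 s10 s1T (lt_le_trans s1d dt2) z.
    rewrite -/(w t) -/G in g1 g2.
    have -> : u s2 z - u s1 z - tau * G = (u s2 z - u t z - (s2 - t) * G) -
      (u s1 z - u t z - (s1 - t) * G) by rewrite /tau; ring.
    rewrite (le_trans (ler_normB _ _))// (le_trans (lerD g2 g1))//.
    rewrite -mulrDr ler_pM2l//.
    rewrite ger0_norm ?subr_ge0// ler0_norm ?subr_le0//.
    by rewrite /tau le_eqVlt; apply/orP; left; apply/eqP; ring.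
  pose y := x - tau * b.
  have yx : `|y - x| <= beta * tau.
    have -> : y - x = - (tau * b) by rewrite /y; ring.
    by rewrite normrN normrM (ger0_norm tau0) mulrC ler_wpM2r.
  have [c [cx _ Ec]] := MVT_dist (D s1) _ x y (dD s1 s10 s1T).
  have cxt : `|c - x| <= beta * tau by exact: le_trans yx.
  exists y; split=> //.
  have taud3 : beta * tau < d3.
    have taud : tau < d3 / (beta + 1) by rewrite /tau; clear -tds1 s2td dt3; lra.
    apply: (@le_lt_trans _ _ ((beta + 1) * tau)); first by rewrite ler_wpM2r// lerDl.
    by rewrite mulrC -ltr_pdivlMr.
  have tauL : tau <= L by rewrite /tau /L; clear -s2t1 t0s1; lra.

  have cZ : `|c - x0| <= beta * L.
    have -> : c - x0 = (c - x) + (x - x0) by ring.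
    rewrite (le_trans (ler_normD _ _))// (le_trans (lerD cxt hx))//.
    by rewrite -mulrDr ler_wpM2l// /tau /L; clear -t0s1; lra.
  have osc z1 z2 : `|z1 - x0| <= beta * L + 1 -> `|z2 - x0| <= beta * L + 1 ->
      `|z1 - z2| <= beta * tau -> `|w t z1 - w s1 z2| <= e + e.
    move=> q1 q2 p5; move: (q1) (q2); rewrite ler_norml => /andP[p1 p2]; rewrite ler_norml => /andP[p3 p4].
    have -> : w t z1 - w s1 z2 = (w t z1 - w t z2) - (w s1 z2 - w t z2) by ring.
    rewrite (le_trans (ler_normB _ _))// lerD//.
      by apply: H3; [rewrite /A; clear -p1 p2 p3 p4; lra..|exact: le_lt_trans taud3].
    by have [] := H1 s1 s10 s1T (lt_le_trans s1d dt1) z2.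
  have hn z : `|z - x0| <= beta * L -> `|z + h - x0| <= beta * L + 1.
    by rewrite !ler_norml => /andP[p1 p2]; apply/andP; clear -p1 p2 h0 h1; split; lra.
  have hn0 z : `|z - x0| <= beta * L -> `|z - x0| <= beta * L + 1.
    by move=> p; apply: (le_trans p); rewrite lerDl.
  have o1 : `|w t (x + h) - w s1 (c + h)| <= e + e.
    apply: osc; [exact: hn|exact: hn|].
    have -> : x + h - (c + h) = x - c by ring.
    by rewrite distrC.
  have o2 : `|w t x - w s1 c| <= e + e.
    by apply: osc; [exact: hn0|exact: hn0|rewrite distrC].
  have r1 := step (x + h); have r2 := step x.
  have S := HS t x h tt0 tt1 xZ h0 h1.
  rewrite -/(w t) in S.
  set S' := _ - _ - _ * _ in S; set r1' := _ - _ - _ in r1; set r2' := _ - _ - _ in r2.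
  have hn00 : h != 0 by rewrite gt_eqF.
  have -> : D s2 x - D s1 y = (tau * S' + r1' - r2' -
      (tau * b) * ((w t (x + h) - w s1 (c + h)) - (w t x - w s1 c))) / h.
    have -> : D s1 y = D s1 x + (w s1 (c + h) - w s1 c) / h * - (tau * b).
      have -> : - (tau * b) = y - x by rewrite /y addrAC subrr add0r.
      by rewrite -Ec addrC subrK.
    exact: transport_step_identity.
  rewrite normrM normfV (gtr0_norm h0) ler_pdivrMr//.
  apply: (@le_trans _ _ (tau * (rho * h) + e * tau + e * tau +
      (tau * beta) * ((e + e) + (e + e)))).
    rewrite (le_trans (ler_normB _ _))// lerD//.
      rewrite (le_trans (ler_normB _ _))// lerD//.
      rewrite (le_trans (ler_normD _ _))// lerD//.
      by rewrite normrM (ger0_norm tau0) ler_wpM2l.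
    rewrite normrM; apply: ler_pM; [exact: normr_ge0|exact: normr_ge0| |].
      by rewrite normrM (ger0_norm tau0) ler_wpM2l.
    by rewrite (le_trans (ler_normB _ _))// lerD.
  have E : e * (2 + 4 * beta) = eps * h by rewrite /e divfK// gt_eqF.
  have -> : tau * (rho * h) + e * tau + e * tau + tau * beta * (e + e + (e + e)) =
    tau * (rho * h) + tau * (e * (2 + 4 * beta)) by ring.
  by rewrite E -/tau le_eqVlt; apply/orP; left; apply/eqP; ring.
have x00 : `|x0 - x0| <= beta * (t1 - t1) by rewrite !subrr mulr0 normr0.
have [y [yx Ey]] := QL x0 x00.
(* Mean value points turn the quotients at both ends of the characteristic back into values of u_x,
   at distance at most [h]. *)
have [c1 [c1x E1]] := quot t1 x0 t10 t1T.
have [c2 [c2y E2]] := quot t0 y t00 t0T.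
exists c2; split.
  have -> : c2 - x0 = (y - x0) + (c2 - y) by ring.
  by rewrite (le_trans (ler_normD _ _))// lerD// (le_trans c2y).
have hc1 := hd c1 (le_lt_trans c1x hd2).
rewrite -/(w t1) -/(w t0).
have -> : w t1 x0 - w t0 c2 = (D t1 x0 - D t0 y) - (w t1 c1 - w t1 x0).
  by rewrite E1 E2; ring.
rewrite (le_trans (ler_normB _ _))// (le_trans (lerD Ey hc1))//.
have epsL : eps * L <= eta / 2.
  rewrite /eps mulrAC ler_pdivrMr// ler_wpM2l ?(ltW eta20)// lerDl//.
have -> : (rho + eps) * (t1 - t0) = rho * (t1 - t0) + eps * L by rewrite /L; ring.
by rewrite -addrA lerD2l [leRHS]splitr lerD2r.
Qed.
End Transport.

(** * Exponential decay *)

Section Sources.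
Context {R : realType}.

Lemma is_derive_exprn (f df : R -> R) (k : nat) : (forall x : R, is_derive x 1 f (df x)) ->
  forall x : R, is_derive x 1 (fun y => f y ^+ k) (k%:R * f x ^+ k.-1 * df x).
Proof.
move=> h x; have hx := h x.
have -> : (fun y => f y ^+ k) = f ^+ k by rewrite exprfctE.
exact: (@is_deriveX _ _ f k x 1 (df x) hx).
Qed.

(* The sum of the coefficients k (k - 1) / 2, 2 * (3 k / 2) and k; the factor 2
   comes from the two terms of the second derivative of Lambda^(-2). *)
Definition source_const (k : nat) : R := (k * (k - 1))%N%:R / 2 + (3 * k)%N%:R + k%:R.

Lemma source_const_ge0 k : 0 <= source_const k.
Proof. by rewrite !addr_ge0 ?divr_ge0. Qed.

(** The second expression is what drives the difference quotient of u: in the increment of u^k u_x,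
    the part u^k(y) (u_x(y + h) - u_x(y)) is transport, and the rest is a source. The mean value
    theorem extracts the factor h: from the nonlocal terms through Lambda^(-2)'' = Lambda^(-2) - 1,
    and from u^k through k u^(k-1) u_x at a point near y, whence a hypothesis with two points. The
    factor expR th moves the weight from the intermediate points back to y. *)
Lemma source_bound (k : nat) (f : R -> R) (M th A : R) (om : R -> R) :
  (forall x : R, is_derive x 1 f (derive1 f x)) -> continuous (derive1 f) ->
  (forall x, `|f x| <= M) -> (forall x, `|derive1 f x| <= M) ->
  0 <= th -> th < 1 -> 0 <= A -> (forall x, 0 <= om x) ->
  (forall x y, om y <= expR (th * `|x - y|) * om x) ->
  (forall y, `|f y ^+ (k - 2) * derive1 f y ^+ 3| <= A * om y) ->
  (forall y, `|f y ^+ (k - 1) * derive1 f y ^+ 2| <= A * om y) ->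
  (forall y z, `|y - z| <= 1 -> `|f y ^+ k.-1 * derive1 f y * derive1 f z| <= A * om y) ->
  (forall x, `|nonlocal_rhs k f x| <= source_const k * (A * om x / (1 - th))) /\
  (forall y h, 0 < h -> h <= 1 ->
     `|nonlocal_rhs k f (y + h) - nonlocal_rhs k f y -
       (f (y + h) ^+ k - f y ^+ k) * derive1 f (y + h)| <=
     source_const k * (A * (expR th * om y) / (1 - th)) * h).
Proof.
move=> df cf' fM f'M th0 th1 A0 om0 omle H1 H2 H3.
have cf := is_derive_continuous _ _ df.
have c1 := continuous_exprM f (derive1 f) (k - 2)%N 3 cf cf'.
have c2 := continuous_exprM f (derive1 f) (k - 1)%N 2 cf cf'.
have b1 y := normM_exp_le (f y) (derive1 f y) M (k - 2)%N 3 (fM y) (f'M y).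
have b2 y := normM_exp_le (f y) (derive1 f y) M (k - 1)%N 2 (fM y) (f'M y).
have L1 x := Lambda_m2_bound _ _ c1 b1 om th A x th1 A0 (om0 x) (omle x) H1.
have L2 x := Lambda_m2_bound _ _ c2 b2 om th A x th1 A0 (om0 x) (omle x) H2.
set f1 := (fun y => f y ^+ (k - 2) * _) in c1 b1 L1.
set f2 := (fun y => f y ^+ (k - 1) * _) in c2 b2 L2.
pose a : R := (k * (k - 1))%N%:R / 2; pose c : R := (3 * k)%N%:R / 2.
have a0 : 0 <= a by rewrite divr_ge0.
have c0 : 0 <= c by rewrite divr_ge0.
have kr0 : 0 <= k%:R :> R by [].
have constE : source_const k = a + 2 * c + k%:R by rewrite /source_const /a /c; field.
have th1' : 0 < 1 - th by rewrite subr_gt0.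
pose B x := A * om x / (1 - th).
have B0 x : 0 <= B x by rewrite divr_ge0 ?mulr_ge0// ltW.
(* As 1 - th <= 1, the local term in the second derivative of Lambda^(-2) obeys the bound of the
   nonlocal ones. *)
have BA x : A * om x <= B x.
  by rewrite /B ler_pdivlMr// ler_piMr ?mulr_ge0// gerBl.
pose N := nonlocal_rhs k f.
pose N' x := a * derive1 (Lambda_m2 f1) x - c * (Lambda_m2 f2 x - f2 x).
have dN (x : R) : is_derive x 1 N (N' x).
  have d1 : is_derive x 1 (Lambda_m2 f1) (derive1 (Lambda_m2 f1) x).
    by rewrite (derive1_Lambda_m2 _ _ c1 b1); exact: (is_derive_Lambda_m2 _ _ c1 b1 x).
  have d2 := is_derive_derive1_Lambda_m2 _ _ c2 b2 x.
  by have := is_deriveB (is_deriveZ a d1) (is_deriveZ c d2).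
have N'le x : `|N' x| <= (a + 2 * c) * B x.
  have [_ h1] := L1 x; have [h2 _] := L2 x.
  rewrite (le_trans (ler_normB _ _))// (normrM a) (normrM c) (ger0_norm a0) (ger0_norm c0) mulrDl lerD//.
    by rewrite ler_wpM2l.
  have -> : 2 * c * B x = c * (B x + B x) by ring.
  apply: ler_wpM2l => //; rewrite (le_trans (ler_normB _ _))//.
  by rewrite lerD// (le_trans (H2 x)).
split.
  move=> x; have [h1 _] := L1 x; have [_ h2] := L2 x.
  rewrite -/(B x) constE (le_trans (ler_normB _ _))// (normrM a) (normrM c) (ger0_norm a0) (ger0_norm c0).
  apply: (@le_trans _ _ (a * B x + c * B x)).
    by rewrite lerD// ler_wpM2l.
  rewrite -mulrDl ler_wpM2r//.
  by clear -c0 kr0; lra.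
move=> y h h0 h1.
have omc (c' : R) : `|c' - y| <= 1 -> om c' <= expR th * om y.
  move=> cy; rewrite (le_trans (omle y c'))// ler_wpM2r// ler_expR.
  by rewrite -[leRHS]mulr1 ler_wpM2l// distrC.
pose B1 := A * (expR th * om y) / (1 - th).
have BB1 (c' : R) : `|c' - y| <= 1 -> B c' <= B1.
  move=> cy; rewrite /B /B1 ler_pM2r ?invr_gt0// ler_wpM2l//.
  exact: omc.
have yh : y + h - y = h by rewrite addrAC subrr add0r.
have [d [dy _ Ed]] := MVT_dist N N' y (y + h) dN.
have [e [ey eyh Ee]] := MVT_dist _ _ y (y + h) (is_derive_exprn f _ k df).
rewrite yh (gtr0_norm h0) in dy ey eyh Ed Ee.
rewrite -/N Ed Ee mulrAC -mulrBl normrM (gtr0_norm h0) ler_pM2r//.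
rewrite -/B1 constE mulrDl (le_trans (ler_normB _ _))// lerD//.
  rewrite (le_trans (N'le d))// ler_wpM2l ?BB1 ?(le_trans dy)//.
  by rewrite addr_ge0// mulr_ge0.
rewrite -!mulrA normrM ger0_norm// ler_wpM2l// mulrA.
rewrite (le_trans (H3 e (y + h) _))//; first exact: (le_trans eyh).
by rewrite (le_trans (BA e))// BB1// (le_trans ey).
Qed.

End Sources.

(** * Propagation of weighted bounds in time *)

Section Decay.
Context {R : realType}.

Lemma ler_addMgt0 (a b c : R) : 0 <= c -> (forall e, 0 < e -> e <= 1 -> a <= b + c * e) -> a <= b.
Proof.
move=> c0 h; apply/ler_addgt0Pr => e e0.
pose d := Num.min 1 (e / (c + 1)).
have c1 : 0 < c + 1 by rewrite ltr_wpDl.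
have d0 : 0 < d by rewrite lt_min ltr01 divr_gt0.
have d1 : d <= 1 by rewrite ge_min lexx.
have d2 : d <= e / (c + 1) by rewrite ge_min lexx orbT.
apply: (le_trans (h d d0 d1)); rewrite lerD2l.
apply: (@le_trans _ _ ((c + 1) * d)); first by rewrite (ler_wpM2r (ltW d0))// lerDl.
by rewrite mulrC -ler_pdivlMr.
Qed.

(** The mean value inequality in time: around each tag the expansion of u gives the slope rho + e,
    [cousin] glues, and e tends to 0. *)
Lemma time_lip (k : nat) (T0 : R) u (t0 t1 rho x : R) : classical_solution k T0 u ->
  0 <= t0 -> t0 <= t1 -> t1 <= T0 ->
  (forall t, t0 <= t -> t <= t1 ->
    `|nonlocal_rhs k (u t) x - u t x ^+ k * derive1 (u t) x| <= rho) ->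
  `|u t1 x - u t0 x| <= rho * (t1 - t0).
Proof.
move=> cs t00 t01 t1T h.
have L0 : 0 <= t1 - t0 by rewrite subr_ge0.
apply: (ler_addMgt0 _ _ _ L0) => e e0 _; rewrite (mulrC _ e) -mulrDl.
pose P a b := `|u b x - u a x| <= (rho + e) * (b - a).
apply: (cousin P) => //.
  move=> a b c _ _ _ _ h1 h2; rewrite /P.
  have -> : u c x - u a x = (u b x - u a x) + (u c x - u b x) by ring.
  rewrite (le_trans (ler_normD _ _))// (le_trans (lerD h1 h2))//.
  by rewrite -mulrDr le_eqVlt; apply/orP; left; apply/eqP; ring.
move=> t tt0 tt1.
have ht : 0 <= t by exact: le_trans tt0.
have hT : t <= T0 by exact: le_trans t1T.
have [d d0 H] := cs_deriv_t _ _ _ cs t ht hT e e0.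
exists d => // s1 s2 t0s1 s1t ts2 s2t1 tds1 s2td.
have s10 : 0 <= s1 by exact: le_trans t0s1.
have s1T : s1 <= T0 by exact: le_trans hT.
have s20 : 0 <= s2 by exact: le_trans ts2.
have s2T : s2 <= T0 by exact: le_trans t1T.
have s1d : `|s1 - t| < d.
  by rewrite ltr_norml; apply/andP; clear -tds1 s1t d0; split; lra.
have s2d : `|s2 - t| < d.
  by rewrite ltr_norml; apply/andP; clear -s2td ts2 d0; split; lra.
have g2 := H s2 s20 s2T s2d x; have g1 := H s1 s10 s1T s1d x; have G0 := h t tt0 tt1.
set G := nonlocal_rhs k (u t) x - _ in g1 g2 G0.
have tau0 : 0 <= s2 - s1 by rewrite subr_ge0; exact: le_trans ts2.
rewrite /P; have -> : u s2 x - u s1 x = (s2 - s1) * G + ((u s2 x - u t x - (s2 - t) * G) -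
      (u s1 x - u t x - (s1 - t) * G)) by ring.
rewrite (le_trans (ler_normD _ _))// [leRHS]mulrDl lerD//.
  by rewrite normrM ger0_norm// mulrC ler_wpM2r.
rewrite (le_trans (ler_normB _ _))// (le_trans (lerD g2 g1))//.
rewrite -mulrDr ler_pM2l// ger0_norm ?subr_ge0// ler0_norm ?subr_le0//.
by rewrite le_eqVlt; apply/orP; left; apply/eqP; ring.
Qed.

(** One factor [b] is set aside to carry the weight; the remaining factors are bounded by [M], and
    [M >= 1] makes all exponents up to [p] admissible. *)
Lemma norm_pow_le (a b M z : R) (m n p : nat) : 1 <= M -> `|a| <= M -> `|b| <= M ->
  `|b| <= z -> (m + n <= p)%N -> `|a ^+ m * b ^+ n.+1| <= M ^+ p * z.
Proof.
move=> M1 aM bM bz mnp.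
rewrite exprSr mulrA normrM ler_pM// (le_trans (normM_exp_le a b M m n aM bM))//.
by rewrite -exprD ler_weXn2l.
Qed.

Definition decays (u : R -> R) (om : R -> R) (K : R) : Prop :=
  forall x, `|u x| <= K * om x /\ `|derive1 u x| <= K * om x.

(** The largest factor by which the weight varies over a backward cone: speed at most M^k during at
    most T0, plus 1 for the tolerance of [transport]. *)
Definition growthE (k : nat) (M th T0 : R) : R := expR (th * (M ^+ k * T0 + 1)).
(** The rate at which sources build up when u and u_x are bounded by the weight: the convolution
    costs 1 / (1 - th), the shift by h costs expR th, and the last M^k is the term u^k u_x in the
    equation for u. *)
Definition growthC (k : nat) (M th T0 : R) : R :=
  source_const k * (M ^+ (k + 2) * (expR th * growthE k M th T0) / (1 - th)) + M ^+ k.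

Lemma growthE_ge1 k M th T0 : 0 <= M -> 0 <= th -> 0 <= T0 -> 1 <= growthE k M th T0.
Proof.
move=> M0 th0 T00; rewrite /growthE -expR0 ler_expR mulr_ge0// addr_ge0// mulr_ge0//.
exact: exprn_ge0.
Qed.

(* The bound [K] assumed on the whole interval reappears multiplied by its length,
   so that over a short interval it is absorbed.  The weight [om] will be bounded
   below, which makes some [K] available, but the constants do not see that lower
   bound. *)
Lemma local_step (k : nat) (T0 M th : R) u (om : R -> R) (t0 t1 W K : R) :
  classical_solution k T0 u -> (0 < k)%N -> 1 <= M ->
  (forall t, 0 <= t -> t <= T0 -> forall x, `|u t x| <= M /\ `|derive1 (u t) x| <= M) ->
  0 <= th -> th < 1 -> (forall x, 0 <= om x) ->
  (forall x y, om y <= expR (th * `|x - y|) * om x) ->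
  0 <= t0 -> t0 <= t1 -> t1 <= T0 -> 0 <= W -> 0 <= K ->
  decays (u t0) om W -> (forall t, t0 <= t -> t <= t1 -> decays (u t) om K) ->
  decays (u t1) om (growthE k M th T0 * W + growthC k M th T0 * K * (t1 - t0)).
Proof.
move=> cs k0 M1 uM th0 th1 om0 omle t00 t01 t1T W0 K0 dW dK x.
have M0 : 0 <= M by exact: le_trans ler01 M1.
have T00 : 0 <= T0 by apply: le_trans t1T; exact: le_trans t01.
have th1' : 0 < 1 - th by rewrite subr_gt0.
have ht0 t : t0 <= t -> 0 <= t by exact: le_trans.
have htT t : t <= t1 -> t <= T0 by move=> h; exact: le_trans t1T.
have L0 : 0 <= t1 - t0 by rewrite subr_ge0.
have Mk0 n : 0 <= M ^+ n by exact: exprn_ge0.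
set E := growthE k M th T0.
have E1 : 1 <= E by exact: growthE_ge1.
have E0 : 0 <= E by exact: le_trans ler01 E1.
have const0 := @source_const_ge0 R k.
(* One factor of each source carries [K]; the others, at most k + 2 in number, are bounded by
   [M]. *)
pose A := M ^+ (k + 2) * K.
have A0 : 0 <= A by rewrite mulr_ge0.
have src t (h0 : t0 <= t) (h1 : t <= t1) :
  (forall x, `|nonlocal_rhs k (u t) x| <= source_const k * (A * om x / (1 - th))) /\
  (forall y h, 0 < h -> h <= 1 ->
     `|nonlocal_rhs k (u t) (y + h) - nonlocal_rhs k (u t) y -
       (u t (y + h) ^+ k - u t y ^+ k) * derive1 (u t) (y + h)| <=
     source_const k * (A * (expR th * om y) / (1 - th)) * h).
  have uMt y := uM t (ht0 t h0) (htT t h1) y.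
  have dKt y := dK t h0 h1 y.
  apply: (@source_bound _ k (u t) M th A om) => //.
  - exact: (cs_is_derive _ _ _ cs t (ht0 t h0) (htT t h1)).
  - exact: (cs_continuous _ _ _ cs t (ht0 t h0) (htT t h1)).
  - by move=> y; have [] := uMt y.
  - by move=> y; have [] := uMt y.
  - move=> y; rewrite /A -mulrA; have [p1 p2] := uMt y; have [_ p3] := dKt y.
    by apply: norm_pow_le => //; rewrite leq_add// leq_subr.
  - move=> y; rewrite /A -mulrA; have [p1 p2] := uMt y; have [_ p3] := dKt y.
    by apply: norm_pow_le => //; rewrite leq_add// leq_subr.
  - move=> y z _; have [p1 p2] := uMt y; have [_ p3] := dKt y; have [_ p4] := uMt z.
    rewrite normrM.
    apply: (@le_trans _ _ ((M ^+ k.-1 * (K * om y)) * M)).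
      rewrite ler_pM// -[derive1 (u t) y]expr1; apply: norm_pow_le => //.
      by rewrite addn0.
    have -> : M ^+ k.-1 * (K * om y) * M = M ^+ k.-1.+1 * (K * om y) by rewrite exprSr; ring.
    rewrite prednK// /A -mulrA ler_wpM2r ?mulr_ge0//.
    by rewrite ler_weXn2l// leq_addr.
have gE : growthC k M th T0 * K * om x =
    source_const k * (A * (expR th * (E * om x)) / (1 - th)) + M ^+ k * (K * om x).
  by rewrite /growthC -/E /A; ring.
split.
  have [p1 _] := dW x.
  have hG t : t0 <= t -> t <= t1 ->
      `|nonlocal_rhs k (u t) x - u t x ^+ k * derive1 (u t) x| <=
      growthC k M th T0 * K * om x.
    move=> h0 h1; have [s1 _] := src t h0 h1.
    have [q1 q2] := uM t (ht0 t h0) (htT t h1) x; have [_ q3] := dK t h0 h1 x.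
    rewrite (le_trans (ler_normB _ _))// gE lerD//.
      rewrite (le_trans (s1 x))// ler_wpM2l// ler_pM2r ?invr_gt0// ler_wpM2l//.
      by rewrite mulrA ler_peMl// mulr_ege1// -expR0 ler_expR.
    rewrite -[derive1 (u t) x]expr1; apply: norm_pow_le => //.
    by rewrite addn0.
  have lip := time_lip _ _ _ _ _ _ _ cs t00 t01 t1T hG.
  have -> : u t1 x = u t0 x + (u t1 x - u t0 x) by ring.
  rewrite (le_trans (ler_normD _ _))// mulrDl lerD//.
    by rewrite (le_trans p1)// ler_wpM2r// ler_peMl.
  by rewrite (le_trans lip)// le_eqVlt; apply/orP; left; apply/eqP; ring.
pose beta := M ^+ k.
pose rho := source_const k * (A * (expR th * (E * om x)) / (1 - th)).
have omE y : `|y - x| <= beta * (t1 - t0) + 1 -> om y <= E * om x.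
  move=> yx; rewrite (le_trans (omle x y))// ler_wpM2r// /E /growthE ler_expR ler_wpM2l//.
  rewrite distrC (le_trans yx)// lerD2r ler_wpM2l ?Mk0//.
  by rewrite lerBlDr (le_trans t1T)// lerDl.
(* [eta <= 1] keeps the point given by [transport] within the range of [omE]. *)
apply: (ler_addMgt0 _ _ _ ler01) => eta eta0 eta1; rewrite mul1r.
have Hb t y : t0 <= t -> t <= t1 -> `|y - x| <= beta * (t1 - t0) -> `|u t y ^+ k| <= beta.
  move=> h0 h1 _; have [q1 _] := uM t (ht0 t h0) (htT t h1) y.
  by rewrite normrX lerXn2r ?nnegrE.
have HS t y h : t0 <= t -> t <= t1 -> `|y - x| <= beta * (t1 - t0) -> 0 < h -> h <= 1 ->
     `|nonlocal_rhs k (u t) (y + h) - nonlocal_rhs k (u t) y -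
       (u t (y + h) ^+ k - u t y ^+ k) * derive1 (u t) (y + h)| <= rho * h.
  move=> h0 h1 yx hh0 hh1; have [_ s2] := src t h0 h1.
  rewrite (le_trans (s2 y h hh0 hh1))// ler_wpM2r ?(ltW hh0)// ler_wpM2l//.
  rewrite ler_pM2r ?invr_gt0// ler_wpM2l// ler_wpM2l ?expR_ge0// omE//.
  by rewrite (le_trans yx)// lerDl.
have [y [yx Ey]] := transport k T0 u t0 t1 x beta rho eta cs t00 t01 t1T (Mk0 k) eta0 Hb HS.
have [_ p2] := dW y.
have -> : derive1 (u t1) x = derive1 (u t0) y + (derive1 (u t1) x - derive1 (u t0) y) by ring.
rewrite (le_trans (ler_normD _ _))// (le_trans (lerD p2 Ey))// addrA lerD2r mulrDl lerD//.
  have -> : E * W * om x = W * (E * om x) by ring.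
  rewrite ler_wpM2l//.
  by rewrite omE// (le_trans yx)// lerD2l.
have -> : growthC k M th T0 * K * (t1 - t0) * om x = growthC k M th T0 * K * om x * (t1 - t0) by ring.
rewrite ler_wpM2r// gE -/rho lerDl mulr_ge0// mulr_ge0//.
Qed.

Lemma ler_addM_exp2 (a b c : R) : 0 <= c -> (forall j : nat, a <= b + c * 2^-1 ^+ j) -> a <= b.
Proof.
move=> c0 h; apply: (ler_addMgt0 _ _ _ c0) => e e0 _.
pose j := Num.truncn e^-1.
apply: (le_trans (h j)); rewrite lerD2l ler_wpM2l//.
rewrite exprVn invf_ple ?posrE ?exprn_gt0//.
rewrite (le_trans (ltW (truncnS_gt _)))//.
by rewrite -natrX ler_nat ltn_expl.
Qed.

(** On a short interval [local_step] improves a bound K to at most E W + K / 2, whose fixed point is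
    2 E W. The iteration starts from K = M / m, and this is the only place where the lower bound [m]
    enters; it disappears in the limit. *)
Lemma decay_interval (k : nat) (T0 M th m : R) u (om : R -> R) (t0 t1 W : R) :
  classical_solution k T0 u -> (0 < k)%N -> 1 <= M ->
  (forall t, 0 <= t -> t <= T0 -> forall x, `|u t x| <= M /\ `|derive1 (u t) x| <= M) ->
  0 <= th -> th < 1 -> 0 < m -> (forall x, m <= om x) ->
  (forall x y, om y <= expR (th * `|x - y|) * om x) ->
  0 <= t0 -> t0 <= t1 -> t1 <= T0 -> 0 <= W ->
  growthC k M th T0 * (t1 - t0) <= 2^-1 ->
  decays (u t0) om W -> decays (u t1) om (2 * growthE k M th T0 * W).
Proof.
move=> cs k0 M1 uM th0 th1 m0 omm omle t00 t01 t1T W0 Ct dW.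
have M0 : 0 <= M by exact: le_trans ler01 M1.
have om0 x : 0 <= om x by exact: le_trans (ltW m0) (omm x).
have T00 : 0 <= T0 by apply: le_trans t1T; exact: le_trans t01.
set E := growthE k M th T0.
have E0 : 0 <= E by apply: le_trans ler01 _; exact: growthE_ge1.
set C := growthC k M th T0 in Ct *.
have C0 : 0 <= C.
  rewrite /C /growthC addr_ge0 ?exprn_ge0// mulr_ge0 ?source_const_ge0// divr_ge0 ?subr_ge0 ?(ltW th1)//.
  by rewrite mulr_ge0 ?exprn_ge0// mulr_ge0 ?expR_ge0.
pose K0 := M / m.
have K00 : 0 <= K0 by rewrite divr_ge0// ltW.
have iter (j : nat) t : t0 <= t -> t <= t1 -> decays (u t) om (2 * E * W + K0 * 2^-1 ^+ j).
  elim: j t => [|j IH] t h0 h1.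
    move=> x; have ht : 0 <= t by exact: le_trans h0.
    have hT : t <= T0 by exact: le_trans t1T.
    have MK : M <= (2 * E * W + K0 * 2^-1 ^+ 0) * om x.
      rewrite expr0 mulr1 mulrDl -[leLHS]add0r lerD ?mulr_ge0//.
      by rewrite /K0 mulrAC ler_pdivlMr// ler_wpM2l.
    by have [p1 p2] := uM t ht hT x; split; exact: le_trans MK.
  have Kj0 : 0 <= 2 * E * W + K0 * 2^-1 ^+ j.
    apply: addr_ge0; first by rewrite mulr_ge0// mulr_ge0.
    by rewrite mulr_ge0// exprn_ge0// invr_ge0.
  have st := local_step k T0 M th u om t0 t W _ cs k0 M1 uM th0 th1 om0 omle t00 h0
    (le_trans h1 t1T) W0 Kj0 dW (fun s s0 s1 => IH s s0 (le_trans s1 h1)).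
  have le1 : E * W + C * (2 * E * W + K0 * 2^-1 ^+ j) * (t - t0) <=
      2 * E * W + K0 * 2^-1 ^+ j.+1.
    apply: (@le_trans _ _ (E * W + (2 * E * W + K0 * 2^-1 ^+ j) * 2^-1)).
      rewrite lerD2l mulrAC mulrC ler_wpM2l//.
      by rewrite (le_trans _ Ct)// ler_wpM2l// lerD2r.
    by rewrite exprSr le_eqVlt; apply/orP; left; apply/eqP; field.
  by move=> x; have [p1 p2] := st x; split; [apply: (le_trans p1)|apply: (le_trans p2)];
    rewrite ler_wpM2r.
have Kom0 x : 0 <= K0 * om x by rewrite (mulr_ge0 K00).
move=> x; split; apply: (ler_addM_exp2 _ _ _ (Kom0 x)) => j;
  have [p1 p2] := iter j t1 t01 (lexx t1) x;
  [apply: (le_trans p1)|apply: (le_trans p2)];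
  by rewrite mulrDl lerD2l mulrAC.
Qed.

(** Restarting [decay_interval] after each time [tau] multiplies the constant by 2 E. *)
Lemma decay_steps (k : nat) (T0 M th m tau : R) u (om : R -> R) (W : R) (n : nat) :
  classical_solution k T0 u -> (0 < k)%N -> 1 <= M ->
  (forall t, 0 <= t -> t <= T0 -> forall x, `|u t x| <= M /\ `|derive1 (u t) x| <= M) ->
  0 <= th -> th < 1 -> 0 < m -> (forall x, m <= om x) ->
  (forall x y, om y <= expR (th * `|x - y|) * om x) ->
  0 <= W -> 0 < tau -> growthC k M th T0 * tau <= 2^-1 ->
  decays (u 0) om W ->
  forall t, 0 <= t -> t <= T0 -> t <= n%:R * tau ->
    decays (u t) om ((2 * growthE k M th T0) ^+ n * W).
Proof.
move=> cs k0 M1 uM th0 th1 m0 omm omle W0 tau0 Ct dW.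
elim: n => [|n IH] t t0 tT.
  rewrite mul0r => t0'; have -> : t = 0 by apply/eqP; rewrite eq_le t0 t0'.
  by rewrite expr0 mul1r.
have M0 : 0 <= M by exact: le_trans ler01 M1.
have T00 : 0 <= T0 by exact: le_trans tT.
set E := growthE k M th T0 in IH *.
have E1 : 1 <= E by exact: growthE_ge1.
have E0 : 0 <= 2 * E by rewrite mulr_ge0// (le_trans ler01).
have om0 x : 0 <= om x by exact: le_trans (ltW m0) (omm x).
have C0 : 0 <= growthC k M th T0.
  rewrite /growthC addr_ge0 ?exprn_ge0// mulr_ge0 ?source_const_ge0// divr_ge0 ?subr_ge0 ?(ltW th1)//.
  by rewrite mulr_ge0 ?exprn_ge0// mulr_ge0 ?expR_ge0 ?(le_trans ler01).
move=> tn.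
case: (leP t (n%:R * tau)) => tn'.
  move=> x; have [p1 p2] := IH t t0 tT tn' x.
  have le : (2 * E) ^+ n * W * om x <= (2 * E) ^+ n.+1 * W * om x.
    rewrite ler_wpM2r// ler_wpM2r// ler_weXn2l//.
    by clear -E1; lra.
  by split; [apply: le_trans le|apply: le_trans le].
have s0 : 0 <= n%:R * tau by rewrite mulr_ge0// ltW.
have sT : n%:R * tau <= T0 by exact: le_trans (ltW tn') tT.
rewrite exprS -mulrA.
apply: (decay_interval k T0 M th m u om (n%:R * tau) t) => //; first exact: ltW.
- by rewrite mulr_ge0// exprn_ge0.
- rewrite (le_trans _ Ct)// ler_wpM2l//.
  by move: tn; rewrite -natr1 mulrDl mul1r lerBlDl.
- exact: IH.
Qed.

Lemma exp_weight_le (th x y : R) : 0 <= th ->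
  expR (- th * `|y|) <= expR (th * `|x - y|) * expR (- th * `|x|).
Proof.
move=> th0; rewrite -expRD ler_expR mulNr (mulNr _ `|x|) -mulrN -mulrBr.
rewrite ler_wpM2l//.
by have := ler_normD (x - y) y; rewrite subrK; clear; lra.
Qed.

(** The length and the number of the steps are fixed before the weight, so the weight may depend on
    the point where the bound is read, with the same constant everywhere. *)
Lemma exp_decay (k : nat) (T0 M th W : R) u :
  classical_solution k T0 u -> 0 < T0 -> (0 < k)%N -> 1 <= M ->
  (forall t, 0 <= t -> t <= T0 -> forall x, `|u t x| <= M /\ `|derive1 (u t) x| <= M) ->
  0 <= th -> th < 1 -> 0 <= W ->
  decays (u 0) (fun x => expR (- th * `|x|)) W ->
  exists2 A, 0 <= A & forall t, 0 <= t -> t <= T0 -> decays (u t) (fun x => expR (- th * `|x|)) A.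
Proof.
move=> cs T00 k0 M1 uM th0 th1 W0 dW.
have M0 : 0 <= M by exact: le_trans ler01 M1.
pose E := growthE k M th T0; pose C := growthC k M th T0.
have E1 : 1 <= E by exact: growthE_ge1 (ltW T00).
have E0 : 0 <= 2 * E by rewrite mulr_ge0// (le_trans ler01).
have C0 : 0 < C.
  rewrite /C /growthC ltr_wpDl ?exprn_gt0 ?(lt_le_trans ltr01)// mulr_ge0 ?source_const_ge0//.
  rewrite divr_ge0 ?subr_ge0 ?(ltW th1)//.
  by rewrite mulr_ge0 ?exprn_ge0// mulr_ge0 ?expR_ge0 ?(le_trans ler01).
pose tau := 2^-1 / C.
have tau0 : 0 < tau by rewrite divr_gt0.
have Ct : C * tau <= 2^-1 by rewrite /tau mulrC divfK// gt_eqF.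
pose n := (Num.truncn (T0 / tau)).+1.
have nT : T0 <= n%:R * tau by rewrite -ler_pdivrMr// ltW// truncnS_gt.
exists ((2 * E) ^+ n * W); first by rewrite mulr_ge0// exprn_ge0.
move=> t t0 tT x.
(* Truncating the weight at the point [x] itself costs nothing at [x]. *)
pose om (y : R) : R := Num.max (expR (- th * `|y|)) (expR (- th * `|x|)).
have omE : om x = expR (- th * `|x|) by rewrite /om maxxx.
rewrite -omE.
have : decays (u t) om ((2 * E) ^+ n * W); last exact.
apply: (decay_steps k T0 M th (expR (- th * `|x|)) tau) => //.
- exact: expR_gt0.
- by move=> y; rewrite /om le_max lexx orbT.
- move=> y z; rewrite /om ge_max.
  apply/andP; split.
    rewrite (le_trans (exp_weight_le th y z th0))// ler_wpM2l ?expR_ge0//.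
    by rewrite le_max lexx.
  rewrite -[leLHS]mul1r ler_pM ?expR_ge0//.
    by rewrite -expR0 ler_expR mulr_ge0.
  by rewrite le_max lexx orbT.
- move=> y; have [p1 p2] := dW y.
  have le : W * expR (- th * `|y|) <= W * om y by rewrite ler_wpM2l// le_max lexx.
  by split; [apply: le_trans le|apply: le_trans le].
- exact: le_trans nT.
Qed.

(* All the sources are at least quadratic in [u] and [u_x], hence decay at a rate
   larger than [th], limited by 2 th and by the rate 1 of the Green function. *)
Lemma refined_decay (k : nat) (T0 M th A : R) u :
  classical_solution k T0 u -> 0 < T0 -> (0 < k)%N -> 1 <= M ->
  (forall t, 0 <= t -> t <= T0 -> forall x, `|u t x| <= M /\ `|derive1 (u t) x| <= M) ->
  0 < th -> th < 1 -> 0 <= A ->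
  (forall t, 0 <= t -> t <= T0 -> decays (u t) (fun x => expR (- th * `|x|)) A) ->
  exists d D : R, [/\ 0 < d, 0 <= D,
    forall t x, 0 <= t -> t <= T0 -> `|u t x - u 0 x| <= D * expR (- (th + d) * `|x|) &
    forall t x, 0 <= t -> t <= T0 -> D * expR (- th * `|x|) <= 1 ->
      exists y, `|y - x| <= D * expR (- th * `|x|) /\
        `|derive1 (u t) x - derive1 (u 0) y| <= D * expR (- (th + d) * `|x|)].
Proof.
move=> cs T00 k0 M1 uM th0 th1 A0 dA.
have M0 : 0 <= M by exact: le_trans ler01 M1.
(* [d <= th] puts e^(- 2 th |x|) below the new weight; half of the gap 1 - th is kept, so that th +
   d < 1. *)
pose d := Num.min th ((1 - th) / 2).
have d0 : 0 < d by rewrite lt_min th0/= divr_gt0// subr_gt0.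
have dth : d <= th by rewrite ge_min lexx.
have d1 : d <= (1 - th) / 2 by rewrite ge_min lexx orbT.
pose th' := th + d.
have th'1 : th' < 1 by rewrite /th'; clear -d1 th1; lra.
have th'0 : 0 <= th' by rewrite addr_ge0// ltW.
have e1 : 0 < 1 - th' by rewrite subr_gt0.
pose om (x : R) : R := expR (- th' * `|x|).
have om0 x : 0 <= om x by exact: expR_ge0.
have omle x y : om y <= expR (th' * `|x - y|) * om x by exact: exp_weight_le.
have w2 (x : R) : expR (- th * `|x|) * expR (- th * `|x|) <= om x.
  rewrite -expRD ler_expR -mulrDl ler_wpM2r// /th'.
  by clear -dth; lra.
have wle (x y : R) : `|x - y| <= 1 -> expR (- th * `|y|) <= expR th * expR (- th * `|x|).
  move=> xy; rewrite (le_trans (exp_weight_le th x y (ltW th0)))// ler_wpM2r ?expR_ge0//.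
  by rewrite ler_expR ler_piMr// ltW.
have Mk0 n : 0 <= M ^+ n by exact: exprn_ge0.
(* Two decaying factors give A^2; expR th compares their weights at points at distance at most 1. *)
pose q := A ^+ 2 * expR th.
have q0 : 0 <= q by rewrite mulr_ge0 ?sqr_ge0 ?expR_ge0.
have quad (a b y z : R) : `|y - z| <= 1 -> `|a| <= A * expR (- th * `|y|) ->
    `|b| <= A * expR (- th * `|z|) -> `|a| * `|b| <= q * om y.
  move=> yz ha hb.
  apply: (@le_trans _ _ ((A * expR (- th * `|y|)) * (A * (expR th * expR (- th * `|y|))))).
    by rewrite ler_pM// (le_trans hb)// ler_wpM2l// wle.
  have -> : A * expR (- th * `|y|) * (A * (expR th * expR (- th * `|y|))) =
    q * (expR (- th * `|y|) * expR (- th * `|y|)) by rewrite /q; ring.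
  by rewrite ler_wpM2l.
have yy (y : R) : `|y - y| <= 1 by rewrite subrr normr0.
pose A2 := M ^+ (k + 2) * q.
have A20 : 0 <= A2 by rewrite mulr_ge0.
have Mle n z : (n <= k + 2)%N -> 0 <= z -> M ^+ n * z <= M ^+ (k + 2) * z.
  by move=> nk z0; rewrite ler_wpM2r// ler_weXn2l.
have src t (h0 : 0 <= t) (h1 : t <= T0) :
  (forall x, `|nonlocal_rhs k (u t) x| <= source_const k * (A2 * om x / (1 - th'))) /\
  (forall y h, 0 < h -> h <= 1 ->
     `|nonlocal_rhs k (u t) (y + h) - nonlocal_rhs k (u t) y -
       (u t (y + h) ^+ k - u t y ^+ k) * derive1 (u t) (y + h)| <=
     source_const k * (A2 * (expR th' * om y) / (1 - th')) * h).
  have uMt y := uM t h0 h1 y; have dAt y := dA t h0 h1 y.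
  apply: (@source_bound _ k (u t) M th' A2 om) => //.
  - exact: (cs_is_derive _ _ _ cs t h0 h1).
  - exact: (cs_continuous _ _ _ cs t h0 h1).
  - by move=> y; have [] := uMt y.
  - by move=> y; have [] := uMt y.
  - move=> y; have [p1 p2] := uMt y; have [_ p3] := dAt y.
    rewrite 2!exprSr !mulrA !normrM -mulrA /A2 -(mulrA (M ^+ (k + 2))).
    apply: (@le_trans _ _ (M ^+ (k - 2 + 1) * (q * om y))); last first.
      by rewrite Mle ?mulr_ge0// leq_add// leq_subr.
    apply: ler_pM; [by rewrite mulr_ge0|by rewrite mulr_ge0| |exact: (quad _ _ _ _ (yy y))].
    by rewrite -normrM exprD; apply: normM_exp_le.
  - move=> y; have [p1 p2] := uMt y; have [_ p3] := dAt y.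
    rewrite expr2 !normrM normrX /A2 -(mulrA (M ^+ (k + 2))).
    apply: (@le_trans _ _ (M ^+ (k - 1) * (q * om y))); last first.
      by rewrite Mle ?mulr_ge0// (leq_trans (leq_subr _ _))// leq_addr.
    apply: ler_pM; [by rewrite exprn_ge0|by rewrite mulr_ge0| |exact: (quad _ _ _ _ (yy y))].
    by rewrite lerXn2r ?nnegrE.
  - move=> y z yz; have [p1 p2] := uMt y; have [_ p3] := dAt y; have [_ p4] := dAt z.
    rewrite !normrM normrX -mulrA /A2 -(mulrA (M ^+ (k + 2))).
    apply: (@le_trans _ _ (M ^+ k.-1 * (q * om y))); last first.
      by rewrite Mle ?mulr_ge0// (leq_trans (leq_pred _))// leq_addr.
    apply: ler_pM; [by rewrite exprn_ge0|by rewrite mulr_ge0| |exact: (quad _ _ _ _ yz)].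
    by rewrite lerXn2r ?nnegrE.
have const0 := @source_const_ge0 R k.
pose D1 := (source_const k * (A2 / (1 - th')) + A2) * T0.
(* [b1] bounds |u^k|, relative to the weight at x, within distance 1 of x. The summands 1 in [D2]
   and [D3] absorb the tolerance of [transport], which will be [om x]. *)
pose b1 := M ^+ k.-1 * A * expR th.
pose D2 := b1 * T0 + 1.
pose D3 := source_const k * (A2 * (expR th' * expR th') / (1 - th')) * T0 + 1.
have A2e : 0 <= A2 / (1 - th') by rewrite divr_ge0// ltW.
have D10 : 0 <= D1 by rewrite mulr_ge0 ?(ltW T00)// addr_ge0// mulr_ge0.
have b10 : 0 <= b1 by rewrite mulr_ge0 ?expR_ge0// mulr_ge0.
have b1T : 0 <= b1 * T0 by rewrite mulr_ge0// ltW.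
have D20 : 0 <= D2 by rewrite addr_ge0.
have r0 : 0 <= source_const k * (A2 * (expR th' * expR th') / (1 - th')).
  by rewrite mulr_ge0// divr_ge0 ?(ltW e1)// mulr_ge0// mulr_ge0 ?expR_ge0.
have D30 : 0 <= D3 by rewrite addr_ge0// mulr_ge0// ltW.
pose D := D1 + D2 + D3.
have D0 : 0 <= D by rewrite addr_ge0// addr_ge0.
have DD1 : D1 <= D by rewrite /D -addrA lerDl addr_ge0.
have DD2 : D2 <= D by rewrite /D (addrC D1) -addrA lerDl addr_ge0.
have DD3 : D3 <= D by rewrite /D lerDr addr_ge0.
have uk t y : 0 <= t -> t <= T0 -> `|u t y ^+ k| <= M ^+ k.-1 * (A * expR (- th * `|y|)).
  move=> h0 h1; have [p1 _] := uM t h0 h1 y; have [p3 _] := dA t h0 h1 y.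
  by rewrite -(prednK k0) exprSr normrM normrX ler_pM// ?exprn_ge0// lerXn2r ?nnegrE.
exists d, D; split => //.
  move=> t x t0 tT; rewrite -/(om x).
  have hG s : 0 <= s -> s <= t ->
      `|nonlocal_rhs k (u s) x - u s x ^+ k * derive1 (u s) x| <=
      (source_const k * (A2 / (1 - th')) + A2) * om x.
    move=> s0 st; have sT : s <= T0 by exact: le_trans tT.
    have [s1 _] := src s s0 sT.
    have [p1 _] := uM s s0 sT x; have [p3 p4] := dA s s0 sT x.
    rewrite (le_trans (ler_normB _ _))// mulrDl lerD//.
      by rewrite (le_trans (s1 x))// -[leRHS]mulrA [in leRHS]mulrAC.
    rewrite -(prednK k0) exprSr normrM normrM -mulrA normrX /A2 -(mulrA (M ^+ _)).
    apply: (@le_trans _ _ (M ^+ k.-1 * (q * om x))); last first.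
      by rewrite Mle ?mulr_ge0// (leq_trans (leq_pred _))// leq_addr.
    apply: ler_pM; [by rewrite exprn_ge0|by rewrite mulr_ge0| |exact: (quad _ _ _ _ (yy x))].
    by rewrite lerXn2r ?nnegrE.
  rewrite (le_trans (time_lip _ _ _ _ _ _ _ cs (lexx 0) t0 tT hG))// subr0.
  rewrite mulrAC ler_wpM2r// (le_trans _ DD1)// ler_wpM2l// addr_ge0// mulr_ge0//.
move=> t x t0 tT hx.
pose beta := b1 * expR (- th * `|x|).
have beta0 : 0 <= beta by rewrite mulr_ge0 ?expR_ge0.
have betaT : beta * (t - 0) <= b1 * T0 * expR (- th * `|x|).
  by rewrite subr0 /beta mulrAC ler_wpM2r ?expR_ge0// ler_wpM2l.
(* The smallness assumption [hx] keeps the backward cone within distance 1 of x, where weights are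
   comparable up to constants. *)
have beta1 : beta * (t - 0) <= 1.
  rewrite (le_trans betaT)// (le_trans _ hx)// ler_wpM2r ?expR_ge0// (le_trans _ DD2)//.
  by rewrite /D2 lerDl.
have Hb s y : 0 <= s -> s <= t -> `|y - x| <= beta * (t - 0) -> `|u s y ^+ k| <= beta.
  move=> s0 st yx; have sT : s <= T0 by exact: le_trans tT.
  rewrite (le_trans (uk s y s0 sT))// /beta /b1 -!mulrA ler_wpM2l// ler_wpM2l//.
  by apply: wle; rewrite distrC (le_trans yx).
pose rho := source_const k * (A2 * (expR th' * (expR th' * om x)) / (1 - th')).
have HS s y h : 0 <= s -> s <= t -> `|y - x| <= beta * (t - 0) -> 0 < h -> h <= 1 ->
     `|nonlocal_rhs k (u s) (y + h) - nonlocal_rhs k (u s) y -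
       (u s (y + h) ^+ k - u s y ^+ k) * derive1 (u s) (y + h)| <= rho * h.
  move=> s0 st yx hh0 hh1; have sT : s <= T0 by exact: le_trans tT.
  have [_ s2] := src s s0 sT.
  rewrite (le_trans (s2 y h hh0 hh1))// ler_wpM2r ?(ltW hh0)// ler_wpM2l//.
  rewrite ler_pM2r ?invr_gt0// ler_wpM2l// ler_wpM2l ?expR_ge0//.
  rewrite (le_trans (omle x y))// ler_wpM2r// ler_expR ler_piMr//.
  by rewrite distrC (le_trans yx).
have eta0 : 0 < om x by exact: expR_gt0.
have [y [yx Ey]] := transport k T0 u 0 t x beta rho (om x) cs (lexx 0) t0 tT beta0 eta0 Hb HS.
exists y; split.
  rewrite (le_trans yx)//; apply: (@le_trans _ _ (D2 * expR (- th * `|x|))).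
    rewrite /D2 mulrDl mul1r lerD// /om ler_expR ler_wpM2r//.
    by rewrite lerN2 lerDl ltW.
  by rewrite ler_wpM2r ?expR_ge0.
rewrite (le_trans Ey)// -/(om x); apply: (@le_trans _ _ (D3 * om x)).
  rewrite /D3 mulrDl mul1r lerD2r subr0.
  have -> : rho = source_const k * (A2 * (expR th' * expR th') / (1 - th')) * om x by rewrite /rho; ring.
  by rewrite mulrAC ler_wpM2r// ler_wpM2l.
by rewrite ler_wpM2r.
Qed.
End Decay.

(** * The limit at infinity *)

Section UniformLimit.
Context {R : realType}.

Lemma simO_uniform_eps (T0 L : R) (f : R -> R -> R) (h : R -> R) :
  (forall e, 0 < e -> exists X, forall t x, 0 <= t -> t <= T0 -> X < `|x| ->
     `| `|f t x| / h x - L| <= e) ->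
  simO_uniform `[0, T0] f h.
Proof.
move=> H; exists L => P /uniform_nbhs [E [[e /= e0 he] EP]].
have [X hX] := H (e / 2) (divr_gt0 e0 (ltr0Sn _ _)).
exists X => // x /= Xx; apply: EP => t; rewrite /= in_itv/= => /andP[t0 tT].
apply: he; rewrite /= distrC (le_lt_trans (hX t x t0 tT Xx))//.
by rewrite ltr_pdivrMr// ltr_pMr// ltr1n.
Qed.

Lemma simO_eps (f h : R -> R) : simO f h ->
  exists L, forall e, 0 < e -> exists X, forall x, X < `|x| -> `| `|f x| / h x - L| <= e.
Proof.
move=> [L hL]; exists L => e e0.
have B : nbhs L [set y | `|L - y| < e] by apply/nbhs_ballP; exists e.
have [X _ hX] := hL _ B; exists X => x Xx.
by rewrite distrC ltW//; exact: hX.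
Qed.

(** From e^(d r) >= d r, which gives the explicit threshold. *)
Lemma exp_small (c d e : R) : 0 <= c -> 0 < d -> 0 < e ->
  exists X, forall r, X < r -> c * expR (- d * r) <= e.
Proof.
move=> c0 d0 e0; exists (c / (d * e)) => r Xr.
have de : 0 < d * e by rewrite mulr_gt0.
rewrite mulNr expRN ler_pdivrMr ?expR_gt0//.
apply: (@le_trans _ _ (e * (d * r))).
  by move: Xr; rewrite ltr_pdivrMr// => /ltW /le_trans; apply; rewrite le_eqVlt; apply/orP; left; apply/eqP; ring.
by rewrite ler_wpM2l ?(ltW e0)// (le_trans _ (expR_ge1Dx _))// lerDr.
Qed.

(** Where |x| > X the limit gives the constant |L| + 1; elsewhere [f] is bounded and the weight is
    at least e^(- th X). *)
Lemma simO_exp_bound (f : R -> R) (M th : R) : 0 <= th -> (forall x, `|f x| <= M) ->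
  simO f (fun x => expR (- th * `|x|)) ->
  exists2 W, 0 <= W & forall x, `|f x| <= W * expR (- th * `|x|).
Proof.
move=> th0 fM /simO_eps [L hL]; have [X hX] := hL 1 ltr01.
have M0 : 0 <= M by exact: le_trans (normr_ge0 _) (fM 0).
have W1 : 0 <= `|L| + 1 by rewrite addr_ge0.
have W2 : 0 <= M * expR (th * X) by rewrite mulr_ge0// expR_ge0.
exists (`|L| + 1 + M * expR (th * X)); first by rewrite addr_ge0.
move=> x; rewrite mulrDl; case: (ltP X `|x|) => xX.
  rewrite -[leLHS]addr0 lerD//; last by rewrite mulr_ge0// expR_ge0.
  rewrite -ler_pdivrMr ?expR_gt0//.
  have -> : `|f x| / expR (- th * `|x|) = L + (`|f x| / expR (- th * `|x|) - L) by ring.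
  by rewrite (le_trans (ler_norm _))// (le_trans (ler_normD _ _))// lerD// hX.
rewrite -[leLHS]add0r; apply: lerD; first by rewrite mulr_ge0// expR_ge0.
rewrite (le_trans (fM x))// -mulrA -expRD ler_peMr// -expR0 ler_expR.
by rewrite mulNr -mulrBr mulr_ge0// subr_ge0.
Qed.

(** Dividing the faster rate th + d by the weight leaves e^(- d c); [c] stands for |x|. *)
Lemma exp_ratio_perturb (a b c th d D e L : R) : 0 <= D ->
  `|a - b| <= D * expR (- (th + d) * c) ->
  `| `|b| / expR (- th * c) - L| <= e ->
  `| `|a| / expR (- th * c) - L| <= D * expR (- d * c) + e.
Proof.
move=> D0 ab bL.
have -> : `|a| / expR (- th * c) - L = (`|a| - `|b|) / expR (- th * c) +
  (`|b| / expR (- th * c) - L) by ring.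
rewrite (le_trans (ler_normD _ _))// lerD// normrM normfV (ger0_norm (expR_ge0 _)).
rewrite ler_pdivrMr ?expR_gt0// (le_trans (ler_dist_dist _ _))// (le_trans ab)//.
rewrite -mulrA -expRD le_eqVlt; apply/orP; left; apply/eqP; congr (_ * expR _); ring.
Qed.

End UniformLimit.

Theorem theorem2p5 (R : realType) (k : nat) (s theta T0 : R) (T : \bar R)
    (u : R -> R -> R) (u0 : R -> R)
    (k_gt0 : (0 < k)%N) (s_gt : 3 / 2 < s)
    (T0_gt0 : 0 < T0) (T0_lt : (T0%:E < T)%E)
    (u_sol : solution k s [set t | 0 <= t /\ (t%:E < T)%E] u)
    (u_init : forall x, u 0 x = u0 x)
    (theta_gt0 : 0 < theta) (theta_lt1 : theta < 1)
    (u0_decay : simO u0 (fun x => expR (- theta * `|x|)))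
    (du0_decay : simO (derive1 u0) (fun x => expR (- theta * `|x|))) :
  simO_uniform `[0, T0] u (fun x => expR (- theta * `|x|)) /\
  simO_uniform `[0, T0] (fun t => derive1 (u t)) (fun x => expR (- theta * `|x|)).
Proof.
have cs := solution_classical k s T0 T u s_gt T0_gt0 T0_lt u_sol.
have uE : u 0 = u0 by exact/funext.
rewrite -uE in u0_decay du0_decay.
have T00 : 0 <= T0 by exact: ltW.
have [M' uM'] := cs_bounded _ _ _ cs.
pose M := Num.max 1 M'.
have M1 : 1 <= M by rewrite le_max lexx.
have uM t : 0 <= t -> t <= T0 -> forall x, `|u t x| <= M /\ `|derive1 (u t) x| <= M.
  move=> t0 tT x; have [p1 p2] := uM' t t0 tT x.
  by rewrite !le_max p1 p2 !orbT.
have u0M x : `|u 0 x| <= M by have [] := uM 0 (lexx 0) T00 x.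
have w0M x : `|derive1 (u 0) x| <= M by have [] := uM 0 (lexx 0) T00 x.
have [W1 W10 hW1] := simO_exp_bound _ _ _ (ltW theta_gt0) u0M u0_decay.
have [W2 W20 hW2] := simO_exp_bound _ _ _ (ltW theta_gt0) w0M du0_decay.
have dW : decays (u 0) (fun x => expR (- theta * `|x|)) (W1 + W2).
  move=> x; split; rewrite mulrDl.
    by rewrite (le_trans (hW1 x))// lerDl mulr_ge0// expR_ge0.
  by rewrite (le_trans (hW2 x))// lerDr mulr_ge0// expR_ge0.
have [A A0 dA] := exp_decay k T0 M theta _ u cs T0_gt0 k_gt0 M1 uM (ltW theta_gt0) theta_lt1
  (addr_ge0 W10 W20) dW.
have [d [D [d0 D0 Hu Hw]]] := refined_decay k T0 M theta A u cs T0_gt0 k_gt0 M1 uM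
  theta_gt0 theta_lt1 A0 dA.
split.
  have [L hL] := simO_eps _ _ u0_decay.
  apply: (simO_uniform_eps _ L) => e e0.
  have e2 : 0 < e / 2 by rewrite divr_gt0.
  have [X1 h1] := hL _ e2; have [X2 h2] := exp_small D d _ D0 d0 e2.
  exists (Num.max X1 X2) => t x t0 tT; rewrite gt_max => /andP[x1 x2].
  rewrite [leRHS]splitr.
  apply: (le_trans (exp_ratio_perturb _ (u 0 x) _ _ d D (e / 2) _ D0 (Hu t x t0 tT) (h1 x x1))).
  by rewrite lerD2r h2.
have [L hL] := simO_eps _ _ du0_decay.
apply: (simO_uniform_eps _ L) => e e0.
have e4 : 0 < e / 4 by rewrite divr_gt0.
have e8 : 0 < e / 8 by rewrite divr_gt0.
have L1 : 0 < `|L| + 1 by rewrite ltr_wpDl.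
(* [sg <= 1] will give |r| <= 2, and the other entry bounds L (r - 1) by e / 4. *)
pose sg := Num.min 1 (e / 4 / (`|L| + 1)).
have sg0 : 0 < sg by rewrite lt_min ltr01 divr_gt0.
have sg1 : sg <= 1 by rewrite ge_min lexx.
have sg2 : sg <= e / 4 / (`|L| + 1) by rewrite ge_min lexx orbT.
have [z z0 hz] := continuous_dist (@expR R) 0 sg (@continuous_expR R) sg0.
(* [zeta] bounds the displacement: [zeta <= 1] makes [Hw] applicable, and [zeta < z] brings the
   ratio of the weights within [sg] of 1. *)
pose zeta := Num.min 1 (z / 2).
have zeta0 : 0 < zeta by rewrite lt_min ltr01 divr_gt0.
have zeta1 : zeta <= 1 by rewrite ge_min lexx.
have zetaz : zeta < z.
  apply: (@le_lt_trans _ _ (z / 2)); first by rewrite ge_min lexx orbT.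
  by clear -z0; lra.
have [X1 h1] := hL _ e8; have [X2 h2] := exp_small D d _ D0 d0 e4.
have [X3 h3] := exp_small D theta _ D0 theta_gt0 zeta0.
(* [X1 + 1], since the foot [y] of the characteristic may be nearer to the origin than [x] by up to
   1. *)
exists (Num.max (X1 + 1) (Num.max X2 X3)) => t x t0 tT.
rewrite !gt_max => /and3P[x1 x2 x3].
have hx := h3 _ x3.
have [y [yx Ey]] := Hw t x t0 tT (le_trans hx zeta1).
have yx' : `| `|x| - `|y| | <= zeta.
  by rewrite (le_trans (ler_dist_dist _ _))// distrC (le_trans yx).
have yX1 : X1 < `|y|.
  by move: yx'; rewrite ler_norml => /andP[_ h]; clear -h x1 zeta1; lra.
pose q := `|derive1 (u 0) y| / expR (- theta * `|y|).
pose r := expR (theta * (`|x| - `|y|)).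
have hq : `|q - L| <= e / 8 by exact: h1.
have hr : `|r - 1| <= sg.
  rewrite /r -expR0; apply: hz; rewrite subr0 normrM (gtr0_norm theta_gt0).
  apply: (le_lt_trans _ zetaz); rewrite (le_trans _ yx')// ler_piMl// ltW//.
have qr : `|derive1 (u 0) y| / expR (- theta * `|x|) = q * r.
  rewrite /q /r -mulrA; congr (_ * _); rewrite -!expRN -expRD; congr expR; ring.
have hqr : `| `|derive1 (u 0) y| / expR (- theta * `|x|) - L| <= e / 4 + e / 4.
  rewrite qr; have -> : q * r - L = (q - L) * r + L * (r - 1) by ring.
  rewrite (le_trans (ler_normD _ _))// lerD//.
    have r2 : `|r| <= 2.
      have -> : r = 1 + (r - 1) by ring.
      rewrite (le_trans (ler_normD _ _))// normr1.
      by clear -hr sg1; lra.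
    rewrite normrM; apply: (@le_trans _ _ (e / 8 * 2)); first by rewrite ler_pM.
    by clear; lra.
  rewrite normrM; apply: (@le_trans _ _ (`|L| * (e / 4 / (`|L| + 1)))).
    by rewrite ler_wpM2l// (le_trans hr).
  rewrite mulrCA ler_piMr ?(ltW e4)// ler_pdivrMr// mul1r lerDl//.
apply: (le_trans (exp_ratio_perturb _ _ _ _ d D _ _ D0 Ey hqr)).
apply: (@le_trans _ _ (e / 4 + (e / 4 + e / 4))); first by rewrite lerD2r h2.
by clear -e0; lra.
Qed.
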